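(* Let $n,N\in\mathbb{N}$, $\Omega=\prod_{i=1}^N[a_i,b_i]$, $\delta\in\mathbb{N}_0^N$, let $\mathcal{D}_i\subseteq S_2^{\delta_i\mathrm{e}_i,n}[\Omega]$ ($i=1,\dots,N$) be admissible and consistent lifted univariate domains, and let $A_\alpha\in\mathbb{R}^{n\times n}[s]$ for $\vec 0\le\alpha\le\delta$. Let $\mathcal{T}:=\prod_{i=1}^N\mathcal{T}_i$ and $\mathcal{A}:=\sum_{\vec 0\le\alpha\le\delta}\mathrm{M}[A_\alpha]\prod_{i=1}^N\mathcal{A}_{i,\alpha_i}$, with $\mathcal{T}_i,\mathcal{A}_{i,j}$ as in the context. Then $\mathcal{T},\mathcal{A}\in\mathbf{\Pi}_N^{n\times n}[\Omega]$.
   Context: Notation: $\alpha\le\beta$ for multi-indices is componentwise; $D^\alpha=\partial_{s_1}^{\alpha_1}\cdots\partial_{s_N}^{\alpha_N}$; $L_2^n[\Omega]$ is the space of square-integrable $\mathbb{R}^n$-valued functions; $\mathbb{R}^{n\times n}[s]$ is the set of $n\times n$ matrix polynomials in $s=(s_1,\dots,s_N)$; $(\mathrm{M}[A]\mathbf{u})(s)=A(s)\mathbf{u}(s)$; $\mathrm{e}_i$ is the $i$th standard basis vector of $\mathbb{R}^N$; $S_2^{\delta,n}[\Omega]:=\{\mathbf{u}\in L_2^n[\Omega]: D^\alpha\mathbf{u}\in L_2^n[\Omega]\ \forall\,\vec 0\le\alpha\le\delta\}$. Univariate domains: for $d\in\mathbb{N}_0$, $[a,b]\subset\mathbb{R}$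 and $B_{j,k},C_{j,k}\in\mathbb{R}^{n\times n}$ ($0\le j,k\le d-1$), consider $\{\mathbf{u}\in S_2^{d,n}[a,b]:\ \sum_{k=0}^{d-1}[B_{j,k}(\partial_s^k\mathbf{u})(a)+C_{j,k}(\partial_s^k\mathbf{u})(b)]=0\ \ \forall j\in\{0,\dots,d-1\}\}$. Let $H_a,H_b\in\mathbb{R}^{nd\times nd}$ be the block matrices with blocks $B_{j,k}$, $C_{j,k}$, and let $Q(z)\in\mathbb{R}^{nd\times nd}$ be block upper triangular with $(k,l)$ block $\frac{z^{l-k}}{(l-k)!}I_n$ for $l\ge k$ and $0$ otherwise. The domain is admissible if $H_a+H_bQ(b-a)$ is invertible (no condition if $d=0$, where the domain is $L_2^n[a,b]$); then set $K:=(H_a+H_bQ(b-a))^{-1}H_b$. Lifted domains: given for each $i$ a univariate domain $\{\mathbf{w}\in S_2^{\delta_i,n}[a_i,b_i]:\ \sum_{k=0}^{\delta_i-1}[B^i_{j,k}(\partial_s^k\mathbf{w})(a_i)+C^i_{j,k}(\partial_s^k\mathbf{w})(b_i)]=0\ \ \forall j\in\{0,\dots,\delta_i-1\}\}$ (i.e. $d=\delta_i$, $[a,b]=[a_i,b_i]$) with parameters $B^i_{j,k},C^i_{j,k}\in\mathbb{R}^{n\times n}$, $\mathcal{D}_i$ is the set of $\mathbf{u}\in S_2^{\delta_i\mathrm{e}_i,n}[\Omega]$ such that for almost every value of the variables $s_j$, $j\ne i$, the function $s_i\mapsto\mathbf{u}(s)$ lies in that univariate domain. $\mathcal{D}_i$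 is admissible if the univariate domain is; its matrix $K$ is denoted $K^i$, with $n\times n$ blocks $K^i_{k,l}$. The (admissible) domains are consistent if $K^i_{k,p}K^j_{\ell,q}=K^j_{\ell,q}K^i_{k,p}$ for all $i\ne j$ and all $k,p\in\{1,\dots,\delta_i\}$, $\ell,q\in\{1,\dots,\delta_j\}$. Operators: with $d=\delta_i$, let $E_1(z):=[I_n,\,zI_n,\dots,\frac{z^{d-1}}{(d-1)!}I_n]^T$ and $E_d(z):=[\frac{z^{d-1}}{(d-1)!}I_n,\dots,zI_n,I_n]^T$, both in $\mathbb{R}^{nd\times n}$. For $0\le j<\delta_i$ define on $L_2^n[\Omega]$ $$(\mathcal{A}_{i,j}\mathbf{v})(s):=\int_{a_i}^{s_i}\tfrac{(s_i-\theta)^{\delta_i-1-j}}{(\delta_i-1-j)!}\mathbf{v}(s)|_{s_i=\theta}\,d\theta-\int_{a_i}^{b_i}\bigl(\tfrac{d^j}{dz^j}E_1\bigr)(s_i-a_i)^TK^iE_{\delta_i}(b_i-\theta)\,\mathbf{v}(s)|_{s_i=\theta}\,d\theta,$$ $\mathcal{A}_{i,\delta_i}:=I$, and $\mathcal{T}_i:=\mathcal{A}_{i,0}$. Products denote composition. PI operators: $\mathbf{\Pi}_1[a,b]$ is the set of operators on $L_2[a,b]$ of the form $(\mathcal{P}\mathbf{v})(s)=P_0(s)\mathbf{v}(s)+\int_a^sP_1(s,\theta)\mathbf{v}(\theta)d\theta+\int_s^bP_2(s,\theta)\mathbf{v}(\theta)d\theta$ with $P_0\in\mathbb{R}[s]$,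 $P_1,P_2\in\mathbb{R}[s,\theta]$. $\mathbf{\Pi}_N[\Omega]$ is the set of finite sums $\sum_{j=1}^{M}\prod_{i=1}^N\mathcal{P}_{j,i}$ with $\mathcal{P}_{j,i}\in\mathbf{\Pi}_1[a_i,b_i]$ acting on variable $s_i$ only. An operator $\mathcal{P}\in\mathcal{L}(L_2^n[\Omega],L_2^m[\Omega])$ is in $\mathbf{\Pi}_N^{m\times n}[\Omega]$ if every entry $[\mathcal{P}]_{k,\ell}$ is in $\mathbf{\Pi}_N[\Omega]$. *)

(* Defs.v *)
From HB Require Import structures.
From mathcomp Require Import all_boot all_order all_algebra.
From mathcomp Require Import all_classical all_reals all_analysis.
From mathcomp.multinomials Require mpoly.

Set Implicit Arguments.
Unset Strict Implicit.
Unset Printing Implicit Defensive.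

Import Order.TTheory GRing.Theory Num.Theory.
Import numFieldNormedType.Exports.

Local Open Scope classical_set_scope.
Local Open Scope ring_scope.

Notation Rn R N := (N.-tuple (measurableTypeR R)).

Section lebesgue_succ.
Context (R : realType) (N : nat).
Variable mu : {sigma_finite_measure set (Rn R N) -> \bar R}.

Definition Rn_cons (p : measurableTypeR R * Rn R N) : Rn R N.+1 :=
  [tuple of p.1 :: p.2].

Lemma measurable_Rn_cons : measurable_fun [set: _] Rn_cons.
Proof. exact: measurable_cons. Qed.

Definition lebesgue_Rn_succ : set (Rn R N.+1) -> \bar R :=
  pushforward (lebesgue_measure \x mu)%E Rn_cons.

HB.instance Definition _ := Measure.copy lebesgue_Rn_succ
  (measure_function_pushforward__canonical__measure_function_Measure
     (lebesgue_measure \x mu)%E measurable_Rn_cons).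

Lemma sigma_finite_lebesgue_Rn_succ : sigma_finite setT lebesgue_Rn_succ.
Proof.
have /sigma_finiteP[F [TF ndF Foo]] := sigma_finiteT (@lebesgue_measure R).
have /sigma_finiteP[G [TG ndG Goo]] := sigma_finiteT mu.
exists (fun k => [set s | F k (thead s) /\ G k [tuple of behead s]]).
  apply/esym; rewrite -subTset => s _.
  have [k _ Fk] : (\bigcup_i F i) (thead s) by rewrite -TF.
  have [l _ Gl] : (\bigcup_i G i) [tuple of behead s] by rewrite -TG.
  exists (maxn k l) => //; split.
  - by move: Fk; apply/subsetPset/ndF/leq_maxl.
  - by move: Gl; apply/subsetPset/ndG/leq_maxr.
move=> k; have [mF Fk] := Foo k; have [mG Gk] := Goo k; split.
  have m1 : measurable ((fun s : Rn R N.+1 => thead s) @^-1` F k).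
    rewrite -[X in measurable X]setTI.
    exact: (@measurable_tnth _ (measurableTypeR R) N.+1 ord0).
  have m2 : measurable ((fun s : Rn R N.+1 => [tuple of behead s]) @^-1` G k).
    by rewrite -[X in measurable X]setTI; exact: measurable_behead.
  exact: (measurableI _ _ m1 m2).
rewrite /lebesgue_Rn_succ /pushforward (_ : _ @^-1` _ = F k `*` G k).
  by rewrite product_measure1E// lte_mul_pinfty// ge0_fin_numE.
have consK x (t : Rn R N) : [tuple of behead (Rn_cons (x, t))] = t.
  exact/val_inj.
by apply/seteqP; split => -[x t] /=; rewrite consK /Rn_cons theadE.
Qed.

HB.instance Definition _ := @Measure_isSigmaFinite.Build _ _ _
  lebesgue_Rn_succ sigma_finite_lebesgue_Rn_succ.

End lebesgue_succ.

(* N-dimensional Lebesgue measure on the Borel sets of R^N, as the iterated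
   product of the one-dimensional one. *)
Fixpoint lebesgue_Rn (R : realType) (N : nat) :
    {sigma_finite_measure set (Rn R N) -> \bar R} :=
  match N with
  | 0 => \d_([tuple])
  | M.+1 => lebesgue_Rn_succ (lebesgue_Rn R M)
  end.

Section box.
Context (R : realType) (N : nat).
Implicit Types (a b : 'I_N -> R) (s : Rn R N).

Definition box a b : set (Rn R N) :=
  [set s | forall i, tnth s i \in `[a i, b i]].

Lemma measurable_box a b : measurable (box a b).
Proof.
rewrite (_ : box a b =
    \bigcap_(i in [set: 'I_N]) (@tnth N _ ^~ i @^-1` `[a i, b i])).
  apply: fin_bigcap_measurable => // i _.
  by rewrite -[X in measurable X]setTI; exact: measurable_tnth.
by apply/seteqP; split => s /= h i; [move=> _|]; exact: h.
Qed.

Definition lebesgue_box a b : {measure set (Rn R N) -> \bar R} :=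
  mrestr (lebesgue_Rn R N) (measurable_box a b).

(* s with its i-th coordinate replaced by t *)
Definition upd s (i : 'I_N) (t : R) : Rn R N :=
  [tuple if k == i then t else tnth s k | k < N].

Definition lift_op (V : Type) (i : 'I_N) (P : (R -> V) -> R -> V)
    (v : Rn R N -> V) : Rn R N -> V :=
  fun s => P (fun t => v (upd s i t)) (tnth s i).

(* F_0 \o F_1 \o ... \o F_(N-1) *)
Definition comp_ops (X : Type) (F : 'I_N -> X -> X) : X -> X :=
  \big[(fun f g => f \o g)/id]_(i < N) F i.

End box.

(* Elements of L_2 are handled through Borel representatives, and operators on
   L_2 through maps on representatives, compared almost everywhere. *)
Section L2.
Context (R : realType) (N : nat) (a b : 'I_N -> R).
Local Notation mu := (lebesgue_box a b).

Definition L2 (n : nat) : set (Rn R N -> 'cV[R]_n) :=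
  [set v : Rn R N -> 'cV[R]_n | forall k, (fun s => v s k 0) \in Lfun mu 2%:E].

Definition L2norm (n : nat) (v : Rn R N -> 'cV[R]_n) : R :=
  Num.sqrt (\int[mu]_s \sum_k v s k 0 ^+ 2).

Definition bounded_operator (m n : nat)
    (P : (Rn R N -> 'cV[R]_n) -> Rn R N -> 'cV[R]_m) : Prop :=
  [/\ forall v, L2 v -> L2 (P v),
      forall v w, L2 v -> L2 w -> {ae mu, forall s, v s = w s} ->
        {ae mu, forall s, P v s = P w s},
      forall c v w, L2 v -> L2 w ->
        {ae mu, forall s, P (fun s' => c *: v s' + w s') s
                          = c *: P v s + P w s}
    & exists c, forall v, L2 v -> L2norm (P v) <= c * L2norm v].

End L2.

Section PI_operators.
Context (R : realType).

Definition PI_op (a b : R) (P0 : {poly R}) (P1 P2 : {poly {poly R}})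
    (v : R -> R) : R -> R := fun s =>
  P0.[s] * v s
  + \int[lebesgue_measure]_(t in `[a, s]) (P1.[t%:P].[s] * v t)
  + \int[lebesgue_measure]_(t in `[s, b]) (P2.[t%:P].[s] * v t).

Definition Pi1 (a b : R) : set ((R -> R) -> R -> R) :=
  [set P | exists P0 P1 P2, P = PI_op a b P0 P1 P2].

Definition PiN (N : nat) (a b : 'I_N -> R) :
    set ((Rn R N -> R) -> Rn R N -> R) :=
  [set P | exists (M : nat) (Q : 'I_M -> 'I_N -> (R -> R) -> R -> R),
     (forall j i, Pi1 (a i) (b i) (Q j i)) /\
     forall v, v \in Lfun (lebesgue_box a b) 2%:E ->
       {ae lebesgue_box a b, forall s, P v s =
          \sum_(j < M) comp_ops (fun i => lift_op i (Q j i)) v s}].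

Definition op_entry (N m n : nat)
    (P : (Rn R N -> 'cV[R]_n) -> Rn R N -> 'cV[R]_m) (k : 'I_m) (l : 'I_n)
    (v : Rn R N -> R) : Rn R N -> R :=
  fun s => P (fun s' => v s' *: delta_mx l 0) s k 0.

Definition PiN_mx (N : nat) (a b : 'I_N -> R) (m n : nat) :
    set ((Rn R N -> 'cV[R]_n) -> Rn R N -> 'cV[R]_m) :=
  [set P | bounded_operator a b P /\ forall k l, PiN a b (op_entry P k l)].

End PI_operators.

Section sobolev.
Context (R : realType) (N : nat).

Definition pderiv (i : 'I_N) (phi : Rn R N -> R) : Rn R N -> R :=
  fun s => derive1 (fun t : R => phi (upd s i t)) (tnth s i).

Definition Dmulti (alpha : 'I_N -> nat) : (Rn R N -> R) -> Rn R N -> R :=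
  comp_ops (fun i => iter (alpha i) (pderiv i)).

Definition smooth (phi : Rn R N -> R) : Prop :=
  forall l : seq 'I_N, let psi := foldr pderiv phi l in
    (forall i s, derivable (fun t : R => psi (upd s i t)) (tnth s i) 1) /\
    continuous (fun x : 'rV[R]_N => psi [tuple x 0 i | i < N]).

(* C^oo functions with compact support in the interior of the box *)
Definition test_function (a b : 'I_N -> R) (phi : Rn R N -> R) : Prop :=
  smooth phi /\ exists a' b' : 'I_N -> R,
    (forall i, a i < a' i /\ b' i < b i) /\
    forall s, ~ box a' b' s -> phi s = 0.

(* g is the weak derivative of u of order alpha in the interior of the box *)
Definition weak_deriv (a b : 'I_N -> R) (alpha : 'I_N -> nat) (n : nat)
    (u g : Rn R N -> 'cV[R]_n) : Prop :=
  forall phi, test_function a b phi -> forall k,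
    \int[lebesgue_box a b]_s (u s k 0 * Dmulti alpha phi s) =
    (-1) ^+ (\sum_i alpha i) * \int[lebesgue_box a b]_s (g s k 0 * phi s).

Definition S2 (a b : 'I_N -> R) (delta : 'I_N -> nat) (n : nat) :
    set (Rn R N -> 'cV[R]_n) :=
  [set u | L2 a b u /\ forall alpha, (forall i, (alpha i <= delta i)%N) ->
     exists2 g, L2 a b g & weak_deriv a b alpha u g].

End sobolev.

Section domains.
Context (R : realType) (n : nat).

Definition of_R1 (w : R -> 'cV[R]_n) : Rn R 1 -> 'cV[R]_n :=
  fun s => w (tnth s ord0).

(* g k is the continuous representative of the k-th derivative of w, which
   gives a meaning to the boundary values. *)
Definition univariate_domain (d : nat) (a b : R)
    (B C : 'I_d -> 'I_d -> 'M[R]_n) : set (R -> 'cV[R]_n) :=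
  [set w | S2 (fun=> a) (fun=> b) (fun=> d) (of_R1 w) /\
     exists g : 'I_d -> R -> 'cV[R]_n,
       (forall k, {within `[a, b], continuous (g k)} /\
          weak_deriv (fun=> a) (fun=> b) (fun=> k : nat)
            (of_R1 w) (of_R1 (g k))) /\
       forall j, \sum_(k < d) (B j k *m g k a + C j k *m g k b) = 0].

(* The condition on s does not involve its i-th coordinate, which is free in R:
   it holds for almost every s in R^N iff it holds for almost every value of
   the other coordinates. *)
Definition lifted_domain (N : nat) (a b : 'I_N -> R) (i : 'I_N) (d : nat)
    (B C : 'I_d -> 'I_d -> 'M[R]_n) : set (Rn R N -> 'cV[R]_n) :=
  [set u | S2 a b (fun j => if j == i then d else 0%N) u /\
     {ae lebesgue_Rn R N, forall s,
        (forall j, j != i -> tnth s j \in `[a j, b j]) ->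
        univariate_domain (a i) (b i) B C (fun t => u (upd s i t))}].

Definition bc_mx (d : nat) (B : 'I_d -> 'I_d -> 'M[R]_n) :
    'M[R]_(\sum_(j < d) n) :=
  \mxblock_(j < d, k < d) B j k.

Definition Q_mx (d : nat) (z : R) : 'M[R]_(\sum_(j < d) n) :=
  \mxblock_(k < d, l < d)
    (if (k <= l)%N then (z ^+ (l - k) / ((l - k)`!)%:R)%:M else 0 : 'M[R]_n).

Definition admissible (d : nat) (a b : R) (B C : 'I_d -> 'I_d -> 'M[R]_n) :=
  bc_mx B + bc_mx C *m Q_mx d (b - a) \in unitmx.

Definition K_mx (d : nat) (a b : R) (B C : 'I_d -> 'I_d -> 'M[R]_n) :
    'M[R]_(\sum_(j < d) n) :=
  invmx (bc_mx B + bc_mx C *m Q_mx d (b - a)) *m bc_mx C.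

Definition K_block (d : nat) (a b : R) (B C : 'I_d -> 'I_d -> 'M[R]_n)
    (k l : 'I_d) : 'M[R]_n :=
  submxblock (K_mx a b B C) k l.

Definition consistent (N : nat) (a b : 'I_N -> R) (delta : 'I_N -> nat)
    (B C : forall i, 'I_(delta i) -> 'I_(delta i) -> 'M[R]_n) : Prop :=
  forall i j, i != j -> forall k p l q,
    K_block (a i) (b i) (B i) (C i) k p *m K_block (a j) (b j) (B j) (C j) l q =
    K_block (a j) (b j) (B j) (C j) l q *m K_block (a i) (b i) (B i) (C i) k p.

End domains.

Section operators.
Context (R : realType) (n : nat).

Definition E1_mx (d : nat) (z : R) : 'M[R]_(\sum_(k < d) n, n) :=
  \mxcol_(k < d) ((z ^+ k / (k`!)%:R)%:M : 'M[R]_n).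

Definition Ed_mx (d : nat) (z : R) : 'M[R]_(\sum_(k < d) n, n) :=
  \mxcol_(k < d) ((z ^+ (d.-1 - k) / ((d.-1 - k)`!)%:R)%:M : 'M[R]_n).

Definition vint (D : set R) (f : R -> 'cV[R]_n) : 'cV[R]_n :=
  \col_k \int[lebesgue_measure]_(t in D) f t k 0.

(* The one-variable operator underlying A_{i,j}, with d = delta_i; it is the
   identity for j = d. *)
Definition A_univ (d : nat) (a b : R) (B C : 'I_d -> 'I_d -> 'M[R]_n)
    (j : nat) (w : R -> 'cV[R]_n) : R -> 'cV[R]_n :=
  if (j < d)%N then fun s =>
    vint `[a, s]
      (fun t => ((s - t) ^+ (d.-1 - j) / ((d.-1 - j)`!)%:R) *: w t)
    - vint `[a, b]
      (fun t => (derive1n j (E1_mx d) (s - a))^T *m K_mx a b B C *m Ed_mx d (b - t)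
                *m w t)
  else w.

Definition mult_op (N : nat) (A : 'M[mpoly.mpoly N R]_n)
    (v : Rn R N -> 'cV[R]_n) : Rn R N -> 'cV[R]_n :=
  fun s => map_mx (mpoly.meval (tnth s)) A *m v s.

Context (N : nat) (a b : 'I_N -> R) (delta : 'I_N -> nat).
Variables B C : forall i, 'I_(delta i) -> 'I_(delta i) -> 'M[R]_n.

Definition A_op (i : 'I_N) (j : nat) :
    (Rn R N -> 'cV[R]_n) -> Rn R N -> 'cV[R]_n :=
  lift_op i (A_univ (a i) (b i) (@B i) (@C i) j).

Definition calT : (Rn R N -> 'cV[R]_n) -> Rn R N -> 'cV[R]_n :=
  comp_ops (fun i => A_op i 0).

(* The multi-indices 0 <= alpha <= delta are the dependent functions
   alpha : forall i, 'I_(delta i).+1. *)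
Definition calA
    (A : {dffun forall i : 'I_N, 'I_(delta i).+1} -> 'M[mpoly.mpoly N R]_n)
    (v : Rn R N -> 'cV[R]_n) : Rn R N -> 'cV[R]_n :=
  fun s => \sum_(alpha : {dffun forall i : 'I_N, 'I_(delta i).+1})
    mult_op (A alpha) (comp_ops (fun i => A_op i (alpha i)) v) s.

End operators.

(* Main.v *)
Require Import Defs.
From HB Require Import structures.
From mathcomp Require Import all_boot all_order all_algebra.
From mathcomp Require Import all_classical all_reals all_analysis.
From mathcomp Require Import measurable_realfun ring lra.
From mathcomp.multinomials Require mpoly.

(* Each A_{i,j} is, entrywise, a one-variable integral operator with polynomial
   kernels: the derivatives of E_1 are polynomial, and the integral over
   [a_i, b_i] splits at s_i. Composing over the distinct variables expands every
   entry into a finite sum, over paths of matrix indices, of compositions of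
   such scalar operators, and multiplication by a monomial is absorbed factor by
   factor because s_i commutes with operators in the other variables.

   Representatives make all these identities hold only almost everywhere. By
   Tonelli, integrating v^2 along one coordinate shows that almost every slice of
   a square-integrable v is square-integrable, and Cauchy-Schwarz on the slices
   bounds each scalar operator on L_2, so it is linear almost everywhere and
   respects almost-everywhere equality. *)

Set Implicit Arguments.
Unset Strict Implicit.
Unset Printing Implicit Defensive.

Import Order.TTheory GRing.Theory Num.Theory.
Import numFieldNormedType.Exports.

Local Open Scope classical_set_scope.
Local Open Scope ring_scope.

(** The obstacle is composition: an identity for [P w] valid off a null set cannot simply be
    substituted under an integral that reads a whole slice. Instead of tracking null sets through
    slices, each scalar operator [G] receives a norm bound; if [v = w] almost everywhere, linearity
    and the bound force [G w - G v] to have norm zero. Borel sets are not complete, so a function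
    equal almost everywhere to a measurable one need not be measurable. Measurability of the output
    is therefore carried as a separate clause, required for all measurable inputs. Scalar operators
    are manipulated as triples of polynomials rather than as functions, so that multiplying by a
    polynomial or inserting a further variable is an edit of this data. *)

(** * Integration against a restricted measure *)

Section integral_mrestr.
Local Open Scope ereal_scope.
Context d (T : measurableType d) (R : realType).
Variables (mu : {measure set T -> \bar R}) (D : set T) (mD : measurable D).

Import HBNNSimple.

Let integral_mrestr_nnsfun (h : {nnsfun T >-> R}) :
  \int[mrestr mu mD]_x (h x)%:E = \int[mu]_(x in D) (h x)%:E.
Proof.
under [LHS]eq_integral do rewrite fimfunE -fsumEFin//.
under [RHS]eq_integral do rewrite fimfunE -fsumEFin//.
rewrite !ge0_integral_fsum//.
- apply: eq_fsbigr => r _.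
  by rewrite !integralZl_indic_nnsfun//= !integral_indic//= setIT.
- by move=> r; exact/measurable_EFinP/measurable_funTS/measurableT_comp.
- by move=> n x _; rewrite EFinM nnfun_muleindic_ge0.
- by move=> r; exact/measurable_EFinP/measurableT_comp.
- by move=> n x _; rewrite EFinM nnfun_muleindic_ge0.
Qed.

(** For simple functions both sides weigh each level set by [mu] of its intersection with [D];
    monotone convergence does the rest. It links [lebesgue_box] to [lebesgue_Rn], where Tonelli is
    available. *)
Lemma ge0_integral_mrestr (f : T -> \bar R) :
  measurable_fun setT f -> (forall x, 0 <= f x) ->
  \int[mrestr mu mD]_x f x = \int[mu]_(x in D) f x.
Proof.
move=> mf f0; pose f_ := nnsfun_approx measurableT mf.
transitivity (limn (fun n => \int[mrestr mu mD]_x (f_ n x)%:E)).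
  rewrite -monotone_convergence//=.
  - apply: eq_integral => x _; apply/esym/cvg_lim => //=.
    by apply: cvg_nnsfun_approx.
  - by move=> n; apply: measurableT_comp => //; exact: measurable_funTS.
  - by move=> n x _; rewrite lee_fin.
  - by move=> x _ a b ab; rewrite lee_fin//; exact/lefP/nd_nnsfun_approx.
under eq_fun do rewrite integral_mrestr_nnsfun.
rewrite -monotone_convergence//=.
- apply: eq_integral => x _; apply/cvg_lim => //.
  by apply: cvg_nnsfun_approx.
- by move=> n; exact/measurable_EFinP/measurable_funTS.
- by move=> n x _; rewrite lee_fin.
- by move=> x _ a b ab; rewrite lee_fin//; exact/lefP/nd_nnsfun_approx.
Qed.

End integral_mrestr.

(** * Exchanging a coordinate with an integration variable *)

Section swap_coordinate.
Context (R : realType).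

Lemma tnth_upd (N : nat) (s : Rn R N) i t k :
  tnth (upd s i t) k = if k == i then t else tnth s k.
Proof. by rewrite tnth_mktuple. Qed.

Lemma tnth_upd_id (N : nat) (s : Rn R N) i t : tnth (upd s i t) i = t.
Proof. by rewrite tnth_upd eqxx. Qed.

Lemma upd_id (N : nat) (s : Rn R N) i : upd s i (tnth s i) = s.
Proof. by apply: eq_from_tnth => k; rewrite tnth_upd; case: eqP => [->|]. Qed.

Lemma measurable_coord (N : nat) (i : 'I_N) d (X : measurableType d)
    (f : X -> Rn R N) : measurable_fun setT f ->
  measurable_fun setT (fun x => tnth (f x) i : measurableTypeR R).
Proof. by move=> mf; exact: (measurableT_comp (@measurable_tnth _ _ N i) mf). Qed.

Lemma measurable_upd (N : nat) (i : 'I_N) d (X : measurableType d)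
    (f : X -> Rn R N) (g : X -> measurableTypeR R) :
  measurable_fun setT f -> measurable_fun setT g ->
  measurable_fun setT (fun x => upd (f x) i (g x) : Rn R N).
Proof.
move=> mf mg; apply/measurable_fun_tnthP => k.
rewrite (_ : _ \o _ = if k == i then g else (@tnth N _ ^~ k) \o f).
  by case: ifP => // _; exact: measurable_coord.
by apply/funext => x /=; rewrite tnth_upd; case: ifP.
Qed.

Local Open Scope ereal_scope.

Lemma ge0_integral_Rn_succ (N : nat) (f : Rn R N.+1 -> \bar R) :
  measurable_fun setT f -> (forall s, 0 <= f s) ->
  \int[lebesgue_Rn R N.+1]_s f s =
  \int[@lebesgue_measure R]_x \int[lebesgue_Rn R N]_s f (Rn_cons (x, s)).
Proof.
move=> mf f0.
transitivity (\int[pushforward ((@lebesgue_measure R) \x (lebesgue_Rn R N))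
  (@Rn_cons R N)]_s f s) => //.
rewrite (ge0_integral_pushforward (@measurable_Rn_cons R N))//.
rewrite preimage_setT fubini_tonelli1//.
  exact: measurableT_comp (@measurable_Rn_cons R N).
by move=> z; exact: f0.
Qed.

Lemma tnth_Rn_cons_lift (N : nat) x (s : Rn R N) (j : 'I_N) :
  tnth (Rn_cons (x, s)) (lift ord0 j) = tnth s j.
Proof. by rewrite /Rn_cons tnthS. Qed.

Lemma upd_Rn_cons0 (N : nat) x (s : Rn R N) t :
  upd (Rn_cons (x, s)) ord0 t = Rn_cons (t, s).
Proof.
apply: eq_from_tnth => k; rewrite tnth_upd.
by case: (unliftP ord0 k) => [j|] -> /=; rewrite ?tnth_Rn_cons_lift.
Qed.

Lemma upd_Rn_cons_lift (N : nat) x (s : Rn R N) (j : 'I_N) t :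
  upd (Rn_cons (x, s)) (lift ord0 j) t = Rn_cons (x, upd s j t).
Proof.
apply: eq_from_tnth => k; rewrite tnth_upd.
case: (unliftP ord0 k) => [l|] -> /=; rewrite ?tnth_Rn_cons_lift//.
by rewrite (inj_eq lift_inj) tnth_upd.
Qed.

Lemma measurable_fun_int1 d (X : measurableType d) (f : X * measurableTypeR R -> \bar R) :
  measurable_fun setT f -> (forall x, 0 <= f x) ->
  measurable_fun setT (fun x => \int[@lebesgue_measure R]_t f (x, t)).
Proof. move=> mf f0; exact: measurable_fun_fubini_tonelli_F. Qed.

(* The map (s, t) |-> (upd s i t, s_i) preserves Lebesgue measure. *)
Lemma integral_swap_coordinate (N : nat) (i : 'I_N)
    (F : measurableTypeR R * Rn R N -> \bar R) :
  measurable_fun setT F -> (forall z, 0 <= F z) ->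
  \int[lebesgue_Rn R N]_s
    \int[@lebesgue_measure R]_t F (tnth s i, upd s i t) =
  \int[lebesgue_Rn R N]_s \int[@lebesgue_measure R]_t F (t, s).
Proof.
elim: N i F => [[]//|N IH] i F mF F0.
have mF1 : measurable_fun setT
    (fun z : Rn R N.+1 * measurableTypeR R => F (tnth z.1 i, upd z.1 i z.2)).
  apply: measurableT_comp => //; apply: measurable_fun_pair.
    exact: measurable_coord.
  exact: measurable_upd.
have mF2 : measurable_fun setT
    (fun z : Rn R N.+1 * measurableTypeR R => F (z.2, z.1)).
  by apply: measurableT_comp => //; exact: measurable_fun_pair.
rewrite (@ge0_integral_Rn_succ N (fun s =>
  \int[@lebesgue_measure R]_t F (tnth s i, upd s i t))); first last.
- by move=> s; exact: integral_ge0.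
- exact: (measurable_fun_int1 mF1).
rewrite (@ge0_integral_Rn_succ N (fun s =>
  \int[@lebesgue_measure R]_t F (t, s))); first last.
- by move=> s; exact: integral_ge0.
- exact: (measurable_fun_int1 mF2).
case: (unliftP ord0 i) => [j|] ij; last first.
  (* Head coordinate: the two sides differ by exchanging the head [x] with [t]. Moving the tail [s]
     outermost on both sides leaves a plain Tonelli exchange. *)
  rewrite ij.
  transitivity (\int[@lebesgue_measure R]_x \int[lebesgue_Rn R N]_s
      \int[@lebesgue_measure R]_t F (x, Rn_cons (t, s))).
    apply: eq_integral => x _; apply: eq_integral => s _.
    by apply: eq_integral => t _; rewrite upd_Rn_cons0.
  have mG : measurable_fun setT (fun z : (measurableTypeR R * Rn R N) * measurableTypeR R =>
      F (z.1.1, Rn_cons (z.2, z.1.2))).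
    apply: measurableT_comp => //; apply: measurable_fun_pair.
      exact: measurableT_comp.
    apply: measurableT_comp; first exact: measurable_Rn_cons.
    by apply: measurable_fun_pair => //; exact: measurableT_comp.
  rewrite (fubini_tonelli (fun z : measurableTypeR R * Rn R N =>
    \int[@lebesgue_measure R]_t F (z.1, Rn_cons (t, z.2)))); first last.
  - by move=> z; exact: integral_ge0.
  - exact: (measurable_fun_int1 mG).
  have mG' : measurable_fun setT (fun z : (measurableTypeR R * Rn R N) * measurableTypeR R =>
      F (z.2, Rn_cons z.1)).
    apply: measurableT_comp => //; apply: measurable_fun_pair => //.
    by apply: measurableT_comp => //; exact: measurable_Rn_cons.
  rewrite [RHS](fubini_tonelli (fun z : measurableTypeR R * Rn R N =>
    \int[@lebesgue_measure R]_t F (t, Rn_cons z))); first last.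
  - by move=> z; exact: integral_ge0.
  - exact: (measurable_fun_int1 mG').
  apply: eq_integral => s _ /=.
  rewrite (fubini_tonelli (fun z : measurableTypeR R * measurableTypeR R =>
    F (z.1, Rn_cons (z.2, s))))//.
  apply: measurableT_comp => //; apply: measurable_fun_pair => //.
  apply: measurableT_comp; first exact: measurable_Rn_cons.
  exact: measurable_fun_pair.
(* Any other coordinate lies in the tail, so the head [x] is a fixed parameter and the induction
   hypothesis applies. *)
rewrite ij; apply: eq_integral => x _ /=.
rewrite -(IH j (fun z => F (z.1, Rn_cons (x, z.2))))//.
  apply: eq_integral => s _; apply: eq_integral => t _.
  by rewrite upd_Rn_cons_lift tnth_Rn_cons_lift.
apply: measurableT_comp => //; apply: measurable_fun_pair => //.
apply: measurableT_comp; first exact: measurable_Rn_cons.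
exact: measurable_fun_pair.
Qed.

End swap_coordinate.

(** * Square-integrable functions on a bounded interval *)

Section interval_integrals.
Context (R : realType).
Local Notation leb := (@lebesgue_measure R).
Implicit Types (al be l u : R) (w k : R -> R).
Local Open Scope ereal_scope.

Lemma lebesgue_itv_cc al be : (al <= be)%R -> leb `[al, be] = (be - al)%:E.
Proof.
move=> ab; rewrite lebesgue_measure_itv/= lte_fin.
by case: ltgtP ab => // -> _; rewrite subrr.
Qed.

(** Domination by [1 + w^2], where the constant is integrable because the interval is bounded. *)
Lemma integrable_sqr_itv al be w : (al <= be)%R ->
  measurable_fun setT w ->
  \int[leb]_(t in `[al, be]) ((w t) ^+ 2)%:E < +oo ->
  leb.-integrable `[al, be] (EFin \o w).
Proof.
move=> ab mw woo.
have mw2 : measurable_fun `[al, be] (fun t => ((w t) ^+ 2)%:E).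
  by apply/measurable_EFinP/measurable_funTS/measurable_funX.
have ig : leb.-integrable `[al, be] (cst 1 \+ (fun t => ((w t) ^+ 2)%:E)).
  apply: integrableD => //.
    apply/integrableP; split; first exact: measurable_cst.
    rewrite (eq_integral (cst 1)); last by move=> t _ /=; rewrite normr1.
    by rewrite integral_cst//= mul1e lebesgue_itv_cc// ltry.
  apply/integrableP; split => //.
  by under eq_integral do rewrite gee0_abs ?lee_fin ?sqr_ge0//.
apply: (le_integrable _ _ _ ig) => //.
  by apply/measurable_EFinP; exact: measurable_funTS.
move=> t _ /=; rewrite lee_fin.
rewrite [leRHS]ger0_norm; last by rewrite addr_ge0// sqr_ge0.
have := sqr_ge0 (`|w t| - 1)%R; rewrite sqrrB real_normK ?num_real//.
have := normr_ge0 (w t); nra.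
Qed.

Lemma integrable_bounded_mul al be l u w k (M : R) :
  (al <= l)%R -> (u <= be)%R ->
  measurable_fun setT k -> (forall t, t \in `[al, be] -> (`|k t| <= M)%R) ->
  measurable_fun setT w ->
  leb.-integrable `[al, be] (EFin \o w) ->
  leb.-integrable `[l, u] (EFin \o (fun t => k t * w t)%R).
Proof.
move=> al_l u_be mk kM mw iw.
have sub : `[l, u] `<=` `[al, be].
  move=> t /=; rewrite !in_itv/= => /andP[lt tu].
  by rewrite (le_trans al_l lt) (le_trans tu u_be).
have {}iw : leb.-integrable `[l, u] (EFin \o w).
  by apply: integrableS iw.
apply: (le_integrable _ _ _ (integrableZl _ M iw)) => //.
  by apply/measurable_EFinP/measurable_funTS; exact: measurable_funM.
move=> t tlu /=; rewrite lee_fin !normrM ler_wpM2r//.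
by rewrite (le_trans (kM t _)) ?ler_norm//; exact: sub.
Qed.

(* Cauchy-Schwarz, from 2 c |w| <= w^2 + c^2 with c the mean of |w|. *)
Lemma sqr_integral_le al be w : (al <= be)%R ->
  measurable_fun setT w ->
  \int[leb]_(t in `[al, be]) ((w t) ^+ 2)%:E < +oo ->
  ((\int[leb]_(t in `[al, be]) `|w t|)%R ^+ 2)%:E <=
  (be - al)%:E * \int[leb]_(t in `[al, be]) ((w t) ^+ 2)%:E.
Proof.
move=> ab mw woo.
have iw := integrable_sqr_itv ab mw woo.
have iaw : leb.-integrable `[al, be] (EFin \o (fun t => `|w t|)%R).
  exact: (integrable_norm iw).
have mw2 : measurable_fun `[al, be] (fun t => ((w t) ^+ 2)%:E).
  by apply/measurable_EFinP/measurable_funTS/measurable_funX.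
set Q := \int[leb]_(t in _) _ in woo *.
have Q0 : 0 <= Q by apply: integral_ge0 => t _; rewrite lee_fin sqr_ge0.
have Qfin : Q \is a fin_num by rewrite ge0_fin_numE.
set A := (\int[leb]_(t in _) _)%R.
have A0 : (0 <= A)%R by exact: Rintegral_ge0.
have EA : A%:E = \int[leb]_(t in `[al, be]) `|w t|%:E.
  by rewrite /A /Rintegral fineK//; exact: integrable_fin_num iaw.
(* On a one-point interval the mean would divide by zero; both sides vanish there. *)
move: ab; rewrite le_eqVlt => /predU1P[ab|ab].
  have -> : A = 0%R.
    by rewrite /A -ab set_itv1 Rintegral_set1.
  by rewrite expr0n/= mule_ge0// lee_fin ab subrr.
have L0 : (0 < be - al)%R by rewrite subr_gt0.
pose c := (A / (be - al))%R.
have c0 : (0 <= c)%R by rewrite divr_ge0// ltW.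
have h : (2 * c)%:E * A%:E <= Q + ((c ^+ 2) * (be - al))%:E.
  rewrite EA -ge0_integralZl//; last 2 first.
  - by apply/measurable_EFinP/measurable_funTS/measurableT_comp.
  - by rewrite lee_fin mulr_ge0.
  rewrite [X in _ + X]EFinM -(lebesgue_itv_cc (ltW ab)) -integral_cst//=.
  rewrite -ge0_integralD//; last 2 first.
  - by move=> t _; rewrite lee_fin sqr_ge0.
  - by move=> t _; rewrite lee_fin sqr_ge0.
  apply: ge0_le_integral => //.
  - by move=> t _; rewrite mule_ge0// lee_fin// mulr_ge0.
  - apply/measurable_EFinP/measurable_funTS/measurable_funM => //.
    exact: measurableT_comp.
  - by apply: emeasurable_funD.
  - move=> t _; rewrite -EFinM -EFinD lee_fin.
    have := sqr_ge0 (`|w t| - c)%R; rewrite sqrrB real_normK ?num_real//.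
    by move=> ?; nra.
rewrite -(fineK Qfin) -EFinM lee_fin.
move: h; rewrite -(fineK Qfin) -EFinM -EFinD lee_fin => h.
have cL : (c * (be - al) = A)%R by rewrite /c divfK// gt_eqF.
clearbody c.
(* Write L for the length [be - al]. Multiplying [2 c A <= Q + c^2 L] by L, with [c L = A], gives
   [2 A^2 <= L Q + A^2]. *)
have : (2 * c * A * (be - al) <= (fine Q + c ^+ 2 * (be - al)) * (be - al))%R.
  by rewrite ler_wpM2r// ltW.
have -> : (2 * c * A * (be - al) = 2 * A ^+ 2)%R by rewrite -cL; ring.
have -> : ((fine Q + c ^+ 2 * (be - al)) * (be - al) =
   (be - al) * fine Q + A ^+ 2)%R by rewrite -cL; ring.
by move=> ?; nra.
Qed.

(** The bound is uniform in [l] and [u], which move with [s_i] in the operators: the integral is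
    dominated by [M] times that of [|w|] over the whole interval before Cauchy-Schwarz is
    applied. *)
Lemma sqr_integral_mul_le al be l u w k (M : R) : (al <= be)%R ->
  (al <= l)%R -> (u <= be)%R ->
  measurable_fun setT k -> (forall t, t \in `[al, be] -> (`|k t| <= M)%R) ->
  measurable_fun setT w ->
  \int[leb]_(t in `[al, be]) ((w t) ^+ 2)%:E < +oo ->
  ((\int[leb]_(t in `[l, u]) (k t * w t))%R ^+ 2)%:E <=
  (M ^+ 2 * (be - al))%:E * \int[leb]_(t in `[al, be]) ((w t) ^+ 2)%:E.
Proof.
move=> ab al_l u_be mk kM mw woo.
have iw := integrable_sqr_itv ab mw woo.
have ikw := integrable_bounded_mul al_l u_be mk kM mw iw.
have iaw : leb.-integrable `[al, be] (EFin \o (fun t => `|w t|)%R).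
  exact: (integrable_norm iw).
have M0 : (0 <= M)%R.
  by rewrite (le_trans _ (kM al _))// in_itv/= lexx.
have sub : `[l, u] `<=` `[al, be].
  move=> t /=; rewrite !in_itv/= => /andP[lt tu].
  by rewrite (le_trans al_l lt) (le_trans tu u_be).
apply: (@le_trans _ _ ((M * \int[leb]_(t in `[al, be]) `|w t|)%R ^+ 2)%:E).
  rewrite lee_fin -[leLHS]real_normK ?num_real// ler_sqr ?nnegrE//; last first.
    by rewrite mulr_ge0// Rintegral_ge0.
  rewrite (le_trans (le_normr_Rintegral _ _))//.
  rewrite -RintegralZl// -lee_fin /Rintegral !fineK; first last.
  - apply: integrable_fin_num => //; exact: (integrable_norm ikw).
  - by apply: integrable_fin_num => //; exact: (integrableZl _ M iaw).
  apply: (@le_trans _ _ (\int[leb]_(t in `[l, u]) (M * `|w t|)%:E)).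
    apply: ge0_le_integral => //.
    + by apply/measurable_EFinP/measurable_funTS/measurableT_comp => //;
        exact: measurable_funM.
    + apply/measurable_EFinP/measurable_funTS/measurable_funM => //.
      exact: measurableT_comp.
    + move=> t tlu; rewrite lee_fin normrM ler_wpM2r//.
      by apply: kM; exact: sub.
  apply: ge0_subset_integral => //.
    apply/measurable_EFinP/measurable_funTS/measurable_funM => //.
    exact: measurableT_comp.
  by move=> t _; rewrite lee_fin mulr_ge0.
rewrite exprMn (EFinM (M ^+ 2)) (EFinM (M ^+ 2) (be - al)) -muleA lee_wpmul2l ?lee_fin ?sqr_ge0//.
exact: sqr_integral_le.
Qed.

End interval_integrals.

(** * Square-integrable functions on the box and bounded operators between them *)

Section L2_box.
Context (R : realType) (N : nat) (a b : 'I_N -> R).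
Hypothesis ab : forall i, a i <= b i.
Local Notation mu := (lebesgue_box a b).
Local Notation leb := (@lebesgue_measure R).
Implicit Types (v : Rn R N -> R) (i : 'I_N).

Lemma ae_box : {ae mu, forall s, box a b s}.
Proof.
exists (~` box a b); split.
- by apply: measurableC; exact: measurable_box.
- by rewrite /lebesgue_box/= /mrestr setICl measure0.
- by [].
Qed.

Lemma box_upd s i t : box a b s -> t \in `[a i, b i] -> box a b (upd s i t).
Proof.
by move=> sab tab k; rewrite tnth_upd; case: eqP => [->|_] //; exact: sab.
Qed.

Local Open Scope ereal_scope.

(** Kept in the extended reals, so that Tonelli and norm estimates can be stated before finiteness
    is known. *)
Definition sqr_norm v : \bar R := \int[mu]_s ((v s) ^+ 2)%:E.

Definition sqr_int v := measurable_fun setT v /\ sqr_norm v < +oo.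

Lemma sqr_norm_ge0 v : 0 <= sqr_norm v.
Proof. by apply: integral_ge0 => s _; rewrite lee_fin sqr_ge0. Qed.

Lemma Lfun2P v : v \in Lfun mu 2%:E <-> sqr_int v.
Proof.
split=> [v2|[mv voo]].
  have := Lfun2_integrable_sqr v2.
  move: v2; rewrite inE => /andP[/[!inE]/= mv _] /integrableP[_].
  by under eq_integral do rewrite gee0_abs ?lee_fin ?sqr_ge0//.
rewrite inE; apply/andP; split; rewrite inE//= /finite_norm unlock.
apply: poweR_lty; apply: le_lt_trans voo; rewrite le_eqVlt; apply/orP; left.
apply/eqP/eq_integral => s _.
by rewrite /= powR_mulrn// real_normK// num_real.
Qed.

Lemma measurable_fun_sqr v : measurable_fun setT v ->
  measurable_fun setT (fun s => ((v s) ^+ 2)%:E).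
Proof. by move=> mv; exact/measurable_EFinP/measurable_funX. Qed.

Lemma ae_eq_sqr_norm v w : measurable_fun setT v -> measurable_fun setT w ->
  {ae mu, forall s, v s = w s} -> sqr_norm v = sqr_norm w.
Proof.
move=> mv mw vw; apply: ae_eq_integral => //; try exact: measurable_fun_sqr.
by apply: filterS vw => s + _ => ->.
Qed.

Lemma measurable_fun_slice_int i (f : Rn R N -> \bar R) :
  measurable_fun setT f -> (forall s, 0 <= f s) ->
  measurable_fun setT (fun s => \int[leb]_(t in `[a i, b i]) f (upd s i t)).
Proof.
move=> mf f0.
have mfu : measurable_fun setT
    (fun z : Rn R N * measurableTypeR R => f (upd z.1 i z.2)).
  by apply: measurableT_comp => //; exact: measurable_upd.
under eq_fun do rewrite integral_mkcond.
apply: (@measurable_fun_int1 _ _ _ (fun z => ((fun t => f (upd z.1 i t)) \_ `[a i, b i]) z.2)).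
  rewrite (_ : (fun _ => _) =
    (fun z : Rn R N * measurableTypeR R => f (upd z.1 i z.2)) \_ (setT `*` `[a i, b i])).
    have mE : measurable ([set: Rn R N] `*` ([set` `[a i, b i]] : set (measurableTypeR R))).
      by apply: measurableX => //; exact: measurable_itv.
    by apply/(measurable_restrictT _ mE); exact: measurable_funTS.
  apply/funext => -[s t]; rewrite !patchE.
  by rewrite in_setX in_setT.
by move=> z; rewrite patchE; case: ifP.
Qed.

(** The conditions [box a b s] and [t] in [[a i, b i]] together say the same as [s_i] in
    [[a i, b i]] and [box a b (upd s i t)]. Swapping [s_i] with [t] then makes the integrand
    independent of one variable, which contributes the length. *)
Lemma ge0_integral_slice i (f : Rn R N -> \bar R) :
  measurable_fun setT f -> (forall s, 0 <= f s) ->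
  \int[mu]_s \int[leb]_(t in `[a i, b i]) f (upd s i t) =
  (b i - a i)%:E * \int[mu]_s f s.
Proof.
move=> mf f0.
have fb0 s : 0 <= (f \_ (box a b)) s by rewrite patchE; case: ifP.
have mfb : measurable_fun setT (f \_ (box a b)).
  apply/(measurable_restrictT _ (measurable_box a b)); exact: measurable_funTS.
have mi := measurable_fun_slice_int i mf f0.
rewrite /lebesgue_box !ge0_integral_mrestr//; last first.
  by move=> s; exact: integral_ge0.
pose F (z : measurableTypeR R * Rn R N) : \bar R :=
  (\1_`[a i, b i] z.1)%:E * (f \_ (box a b)) z.2.
rewrite integral_mkcond.
transitivity (\int[lebesgue_Rn R N]_s \int[leb]_t F (tnth s i, upd s i t)).
  apply: eq_integral => s _; rewrite patchE; case: ifPn => sab.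
    rewrite integral_mkcond; apply: eq_integral => t _.
    move: sab; rewrite inE => sab.
    rewrite /F/= indicE mem_set ?mul1e//; last exact: sab.
    rewrite !patchE; case: ifPn => tab.
      by rewrite mem_set//; apply: box_upd => //; rewrite inE in tab.
    rewrite memNset// => /(_ i); rewrite tnth_upd_id => ht.
    by move: tab; rewrite mem_set.
  apply/esym/integral0_eq => t _; rewrite /F/= indicE.
  case: (boolP (_ \in _)) => siab; last by rewrite mul0e.
  rewrite mul1e patchE memNset// => ub; move/negP: sab; apply.
  rewrite inE => k; have := ub k; rewrite tnth_upd; case: eqP => [->|//] _.
  by move: siab; rewrite inE.
rewrite integral_swap_coordinate//; last 2 first.
- apply: emeasurable_funM.
    by apply/measurable_EFinP; exact: measurableT_comp.
  exact: measurableT_comp.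
- by move=> z; rewrite /F mule_ge0// lee_fin.
rewrite [in RHS]integral_mkcond -ge0_integralZl//; last first.
  by rewrite lee_fin subr_ge0.
apply: eq_integral => s _; rewrite /F/=.
under eq_integral do rewrite muleC.
rewrite ge0_integralZl//; last by apply/measurable_EFinP; exact: measurable_indic.
by rewrite integral_indic// setIT -(lebesgue_itv_cc (ab i)) muleC.
Qed.

Lemma ae_slice i v : sqr_int v -> {ae mu, forall s,
  \int[leb]_(t in `[a i, b i]) ((v (upd s i t)) ^+ 2)%:E < +oo}.
Proof.
move=> [mv voo].
have mv2 := measurable_fun_sqr mv.
have v20 (s : Rn R N) : 0 <= ((v s) ^+ 2)%:E by rewrite lee_fin sqr_ge0.
have phi0 s : 0 <= \int[leb]_(t in `[a i, b i]) ((v (upd s i t)) ^+ 2)%:E.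
  by apply: integral_ge0.
have phi_int : mu.-integrable setT
    (fun s => \int[leb]_(t in `[a i, b i]) ((v (upd s i t)) ^+ 2)%:E).
  apply/integrableP; split; first exact: measurable_fun_slice_int mv2 v20.
  under eq_integral do rewrite gee0_abs//.
  by rewrite (ge0_integral_slice i mv2 v20) lte_mul_pinfty// lee_fin subr_ge0.
apply: filterS (integrable_ae measurableT phi_int) => s /(_ I).
by rewrite ge0_fin_numE.
Qed.

(** What a bounded linear operator on L_2 looks like on representatives. Linearity is only almost
    everywhere because integrals over non-integrable slices take a default value; the exceptional
    set may depend on [c], [v] and [w]. *)
Definition L2_bounded (G : (Rn R N -> R) -> Rn R N -> R) :=
  [/\ forall v, measurable_fun setT v -> measurable_fun setT (G v),
      forall c v w, sqr_int v -> sqr_int w ->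
        {ae mu, forall s, G (fun s => c * v s + w s)%R s = (c * G v s + G w s)%R}
    & exists2 c, (0 <= c)%R &
        forall v, sqr_int v -> sqr_norm (G v) <= c%:E * sqr_norm v].

(** A squared triangle inequality, from [(c v - w)^2 >= 0]. The lost factor 2 is harmless, since
    only the existence of norm bounds matters. *)
Lemma sqr_norm_lin c v w : measurable_fun setT v -> measurable_fun setT w ->
  sqr_norm (fun s => c * v s + w s)%R <=
  (2 * c ^+ 2)%:E * sqr_norm v + 2%:E * sqr_norm w.
Proof.
move=> mv mw; have mv2 := measurable_fun_sqr mv; have mw2 := measurable_fun_sqr mw.
have sq0 (f : Rn R N -> R) k : (0 <= k)%R ->
    forall s, setT s -> 0 <= k%:E * ((f s) ^+ 2)%:E.
  by move=> k0 s _; rewrite mule_ge0// lee_fin ?sqr_ge0.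
have Z (f : Rn R N -> R) k : measurable_fun setT f -> (0 <= k)%R ->
    k%:E * sqr_norm f = \int[mu]_s (k%:E * ((f s) ^+ 2)%:E).
  move=> mf k0; rewrite ge0_integralZl//; first exact: measurable_fun_sqr.
  by move=> s _; rewrite lee_fin sqr_ge0.
have c0 : (0 <= 2 * c ^+ 2)%R by rewrite mulr_ge0// sqr_ge0.
rewrite !Z// -ge0_integralD//; try exact: emeasurable_funM; try exact: sq0.
apply: ge0_le_integral => //.
- by move=> s _; rewrite lee_fin sqr_ge0.
- by apply: measurable_fun_sqr; apply: measurable_funD => //; exact: measurable_funM.
- by apply: emeasurable_funD; exact: emeasurable_funM.
- move=> s _; rewrite -!EFinM -EFinD lee_fin.
  have := sqr_ge0 (c * v s - w s)%R; rewrite !sqrrB !sqrrD !exprMn => ?.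
  by nra.
Qed.

Lemma sqr_int_lin c v w : sqr_int v -> sqr_int w ->
  sqr_int (fun s => c * v s + w s)%R.
Proof.
move=> [mv voo] [mw woo]; split.
  by apply: measurable_funD => //; exact: measurable_funM.
apply: (le_lt_trans (sqr_norm_lin _ mv mw)); apply: lte_add_pinfty.
  by rewrite lte_mul_pinfty// lee_fin mulr_ge0// sqr_ge0.
by rewrite lte_mul_pinfty.
Qed.

Lemma sqr_norm0 : sqr_norm (fun=> 0%R) = 0.
Proof. by rewrite /sqr_norm; under eq_integral do rewrite expr0n/=; exact: integral0. Qed.

Lemma sqr_int0 : sqr_int (fun=> 0%R).
Proof. by split; [exact: measurable_cst|rewrite sqr_norm0]. Qed.

Lemma sqr_intD v w : sqr_int v -> sqr_int w -> sqr_int (fun s => v s + w s)%R.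
Proof.
move=> v2 w2; rewrite (_ : (fun _ => _) = (fun s => 1 * v s + w s)%R).
  exact: sqr_int_lin.
by apply/funext => s; rewrite mul1r.
Qed.

Lemma sqr_int_sum (I : Type) (r : seq I) (f : I -> Rn R N -> R) :
  (forall k, sqr_int (f k)) -> sqr_int (fun s => \sum_(k <- r) f k s)%R.
Proof.
move=> f2; elim: r => [|k r IH].
  by under eq_fun do rewrite big_nil; exact: sqr_int0.
by under eq_fun do rewrite big_cons; exact: sqr_intD.
Qed.

Lemma sqr_norm_eq0 v : measurable_fun setT v -> sqr_norm v = 0 ->
  {ae mu, forall s, v s = 0%R}.
Proof.
move=> mv v0; have /(ae_eq_integral_abs mu measurableT) [+ _] := measurable_fun_sqr mv.
have <- : sqr_norm v = \int[mu]_s `|((v s) ^+ 2)%:E|.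
  by apply: eq_integral => s _; rewrite gee0_abs// lee_fin sqr_ge0.
move=> /(_ v0); apply: filterS => s /(_ I) /= [] /eqP.
by rewrite sqrf_eq0 => /eqP.
Qed.

Lemma L2_bounded_sqr_int G v : L2_bounded G -> sqr_int v -> sqr_int (G v).
Proof.
move=> [mG _ [c c0 Gc]] v2; split; first by apply: mG; case: v2.
by apply: (le_lt_trans (Gc _ v2)); rewrite lte_mul_pinfty//; case: v2.
Qed.

(** The function [u = - v + w] has norm zero, hence so does [G u], which is [- G v + G w] almost
    everywhere. *)
Lemma L2_bounded_ae_eq G v w : L2_bounded G -> sqr_int v -> sqr_int w ->
  {ae mu, forall s, v s = w s} -> {ae mu, forall s, G v s = G w s}.
Proof.
move=> [mG linG [c c0 Gc]] v2 w2 vw.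
have u2 := sqr_int_lin (-1)%R v2 w2.
set u := (fun s => _) in u2.
have u0 : sqr_norm u = 0.
  rewrite -sqr_norm0; apply: ae_eq_sqr_norm; [by case: u2|exact: measurable_cst|].
  by apply: filterS vw => s vws; rewrite /u vws mulN1r addNr.
have Gu0 : sqr_norm (G u) = 0.
  apply/eqP; rewrite eq_le sqr_norm_ge0 andbT.
  by have := Gc _ u2; rewrite u0 mule0.
have := sqr_norm_eq0 (mG _ u2.1) Gu0; apply: filterS2 (linG (-1)%R v w v2 w2) => s.
by rewrite -/u => ->; rewrite mulN1r addrC => /eqP; rewrite subr_eq0 => /eqP.
Qed.

Lemma L2_bounded_ae0 G : L2_bounded G -> {ae mu, forall s, G (fun=> 0%R) s = 0%R}.
Proof.
move=> [_ linG _]; have := linG (-1)%R _ _ sqr_int0 sqr_int0.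
apply: filterS => s; rewrite (_ : (fun _ => _) = fun=> 0%R).
  by rewrite mulN1r addNr.
by apply/funext => ?; rewrite mulr0 addr0.
Qed.

Lemma L2_bounded_aeD G v w : L2_bounded G -> sqr_int v -> sqr_int w ->
  {ae mu, forall s, G (fun s => v s + w s)%R s = (G v s + G w s)%R}.
Proof.
move=> [_ linG _] v2 w2; have := linG 1%R _ _ v2 w2; apply: filterS => s.
rewrite mul1r => <-; congr (G _ s); apply/funext => ?; rewrite mul1r//.
Qed.

Lemma L2_bounded_ae_sum G (I : Type) (r : seq I) (f : I -> Rn R N -> R) :
  L2_bounded G -> (forall k, sqr_int (f k)) ->
  {ae mu, forall s, G (fun s => \sum_(k <- r) f k s)%R s = (\sum_(k <- r) G (f k) s)%R}.
Proof.
move=> LG f2; elim: r => [|k r IH].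
  have E : (fun s => \sum_(k <- [::]) f k s)%R = fun=> 0%R.
    by apply/funext => s; rewrite big_nil.
  by apply: filterS (L2_bounded_ae0 LG) => s; rewrite E big_nil.
have E : (fun s => \sum_(j <- k :: r) f j s)%R =
    fun s => (f k s + (fun s => \sum_(j <- r) f j s) s)%R.
  by apply/funext => s; rewrite big_cons.
apply: filterS2 (L2_bounded_aeD LG (f2 k) (sqr_int_sum r f2)) IH => s.
by rewrite E => -> ->; rewrite big_cons.
Qed.

Lemma L2_bounded_id : L2_bounded id.
Proof.
split=> //; first by move=> c v w _ _; exact: aeW.
by exists 1%R => // v _; rewrite mul1e.
Qed.

Lemma L2_bounded_comp G H : L2_bounded G -> L2_bounded H -> L2_bounded (G \o H).
Proof.
move=> LG LH.
have [mG linG [c c0 Gc]] := LG; have [mH linH [d d0 Hd]] := LH; split.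
- by move=> v mv; apply: mG; exact: mH.
- move=> e v w v2 w2 /=.
  have Hv := L2_bounded_sqr_int LH v2; have Hw := L2_bounded_sqr_int LH w2.
  have Hl := L2_bounded_sqr_int LH (sqr_int_lin e v2 w2).
  have := linG e _ _ Hv Hw.
  (* Linearity of [H] holds only almost everywhere, so [G] must be shown not to see the
     difference. *)
  apply: filterS2 (L2_bounded_ae_eq LG Hl (sqr_int_lin e Hv Hw) (linH e _ _ v2 w2)).
  by move=> s -> ->.
- exists (c * d)%R; first exact: mulr_ge0.
  move=> v v2; apply: (le_trans (Gc _ (L2_bounded_sqr_int LH v2))).
  by rewrite EFinM -muleA lee_wpmul2l// ?lee_fin//; exact: Hd.
Qed.

Lemma L2_boundedD G H : L2_bounded G -> L2_bounded H ->
  L2_bounded (fun v s => G v s + H v s)%R.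
Proof.
move=> [mG linG [c c0 Gc]] [mH linH [d d0 Hd]]; split.
- by move=> v mv; apply: measurable_funD; [exact: mG|exact: mH].
- move=> e v w v2 w2; apply: filterS2 (linG e _ _ v2 w2) (linH e _ _ v2 w2) => s.
  by move=> -> ->; rewrite mulrDr addrACA.
- exists (2 * c + 2 * d)%R; first by rewrite addr_ge0// mulr_ge0.
  move=> v v2; have := sqr_norm_lin 1 (mG _ v2.1) (mH _ v2.1).
  rewrite (_ : (fun _ => _) = (fun s => G v s + H v s)%R); last first.
    by apply/funext => s; rewrite mul1r.
  move=> /le_trans; apply; rewrite expr1n mulr1 (EFinD (2 * c)).
  rewrite ge0_muleDl ?lee_fin ?mulr_ge0// leeD// (EFinM 2) -muleA lee_wpmul2l//.
    exact: Gc.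
  exact: Hd.
Qed.

Lemma L2_bounded0 : L2_bounded (fun _ _ => 0%R).
Proof.
split; first by move=> v _; exact: measurable_cst.
  by move=> c v w _ _; apply: aeW => s; rewrite mulr0 addr0.
by exists 0%R => // v _; rewrite sqr_norm0 mul0e.
Qed.

Lemma L2_bounded_sum (I : Type) (r : seq I) G : (forall k : I, L2_bounded (G k)) ->
  L2_bounded (fun v s => \sum_(k <- r) G k v s)%R.
Proof.
move=> LG; elim: r => [|k r IH].
  rewrite (_ : (fun _ => _) = (fun _ _ => 0%R)); first exact: L2_bounded0.
  by apply/funext => v; apply/funext => s; rewrite big_nil.
rewrite (_ : (fun _ => _) =
  (fun v s => G k v s + (fun v s => \sum_(k <- r) G k v s) v s)%R).
  exact: L2_boundedD.
by apply/funext => v; apply/funext => s; rewrite big_cons.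
Qed.

End L2_box.

(** * Measurability and bounds for polynomials in one and two variables *)

Section polynomials.
Context (R : realType).
Implicit Types (p : {poly R}) (P : {poly {poly R}}).

Lemma measurable_horner d (X : measurableType d) p (f : X -> R) :
  measurable_fun setT f -> measurable_fun setT (fun x => p.[f x]).
Proof.
move=> mf; elim/poly_ind: p => [|p c IH].
  by under eq_fun do rewrite horner0; exact: measurable_cst.
under eq_fun do rewrite hornerMXaddC.
apply: measurable_funD; last exact: measurable_cst.
exact: measurable_funM.
Qed.

(** In [{poly {poly R}}] the outer variable is the integration variable and the coefficients are
    polynomials in the output variable. *)
Lemma measurable_horner2 d (X : measurableType d) P (f g : X -> R) :
  measurable_fun setT f -> measurable_fun setT g ->
  measurable_fun setT (fun x => P.[(g x)%:P].[f x]).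
Proof.
move=> mf mg; elim/poly_ind: P => [|P c IH].
  by under eq_fun do rewrite !horner0; exact: measurable_cst.
under eq_fun do rewrite hornerMXaddC hornerD hornerM hornerC.
apply: measurable_funD; last exact: measurable_horner.
exact: measurable_funM.
Qed.

Lemma horner_bounded (al be : R) p :
  exists M, forall t, t \in `[al, be] -> `|p.[t]| <= M.
Proof.
elim/poly_ind: p => [|p c [M pM]].
  by exists 0 => t _; rewrite horner0 normr0.
(* On the interval [|t|] is at most [|al| + |be|]. *)
exists (M * (`|al| + `|be|) + `|c|) => t tab; rewrite hornerMXaddC.
rewrite (le_trans (ler_normD _ _))// lerD// normrM ler_pM//; first exact: pM.
move: tab; rewrite in_itv/= => /andP[al_t t_be].
have := ler_norm be; have := ler_norm (- al); rewrite normrN.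
have := normr_ge0 al; have := normr_ge0 be.
by case: (ler0P t) => ?; lra.
Qed.

Lemma horner2_bounded (al be : R) P : exists M, forall s t,
  s \in `[al, be] -> t \in `[al, be] -> `|P.[t%:P].[s]| <= M.
Proof.
elim/poly_ind: P => [|P c [M PM]].
  by exists 0 => s t _ _; rewrite !horner0 normr0.
have [L cL] := horner_bounded al be c.
have [T XT] := horner_bounded al be 'X.
exists (M * T + L) => s t sab tab; rewrite hornerMXaddC hornerD hornerM hornerC.
rewrite (le_trans (ler_normD _ _))// lerD ?cL// normrM ler_pM// ?PM//.
by have := XT t tab; rewrite hornerX.
Qed.

End polynomials.

(** The moving bounds become the indicator of the measurable set [E]. Tonelli gives measurability
    for the positive and negative parts separately, so the result covers every measurable [h],
    including points where the integral defaults. *)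
Lemma measurable_Rintegral_itv (R : realType) d (X : measurableType d)
    (h : X * measurableTypeR R -> R) (l u : X -> R) :
  measurable_fun setT h -> measurable_fun setT l -> measurable_fun setT u ->
  measurable_fun setT
    (fun x => \int[@lebesgue_measure R]_(t in `[l x, u x]) h (x, t)).
Proof.
move=> mh ml mu.
pose E := [set z : X * measurableTypeR R | l z.1 <= z.2] `&`
          [set z : X * measurableTypeR R | z.2 <= u z.1].
have mE : measurable E.
  apply: measurableI; rewrite -[X in measurable X]setTI;
    apply: measurable_fun_le => //; exact: measurableT_comp.
have {}mh : measurable_fun setT ((EFin \o h) \_ E).
  by apply/(measurable_restrictT _ mE)/measurable_funTS/measurable_EFinP.
apply: (measurableT_comp (fine_measurable measurableT)).
rewrite (_ : (fun _ => _) = (fun x =>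
    (\int[@lebesgue_measure R]_t ((EFin \o h) \_ E)^\+ (x, t) -
     \int[@lebesgue_measure R]_t ((EFin \o h) \_ E)^\- (x, t))%E)).
  apply: emeasurable_funB; apply: measurable_fun_int1 => //.
    exact: measurable_funepos.
  exact: measurable_funeneg.
apply/funext => x; rewrite integral_mkcond integralE.
have -> : (fun t => (h (x, t))%:E) \_ `[l x, u x] =
    (fun t => ((EFin \o h) \_ E) (x, t)); last first.
  by congr (_ - _)%E; apply: eq_integral => t _; rewrite ?funeposE ?funenegE.
apply/funext => t; rewrite !patchE; congr (if _ then _ else _).
apply/idP/idP; rewrite !inE/= in_itv/=; first by move=> /andP.
by case=> -> ->.
Qed.

(** * Boundedness of one-variable PI operators lifted to the box *)

Section PI_bounded.
Context (R : realType) (N : nat) (a b : 'I_N -> R).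
Hypothesis ab : forall i, a i <= b i.
Local Notation mu := (lebesgue_box a b).
Local Notation leb := (@lebesgue_measure R).
Implicit Types (v : Rn R N -> R) (i : 'I_N).

Lemma measurable_slice v (s : Rn R N) i : measurable_fun setT v ->
  measurable_fun setT (fun t : measurableTypeR R => v (upd s i t)).
Proof. by move=> mv; apply: measurableT_comp => //; exact: measurable_upd. Qed.

Lemma ae_slice_integrable i v : sqr_int a b v -> {ae mu, forall s,
  leb.-integrable `[a i, b i] (EFin \o (fun t => v (upd s i t)))}.
Proof.
move=> v2; apply: filterS (ae_slice ab i v2) => s.
by apply: integrable_sqr_itv => //; apply: measurable_slice; case: v2.
Qed.

(** Bounds given as functions of [s_i] cover at once the ranges [[a_i, s_i]], [[s_i, b_i]] and
    [[a_i, b_i]]. *)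
Definition kernel_op i (l u : R -> R) (P : {poly {poly R}}) v (s : Rn R N) : R :=
  \int[leb]_(t in `[l (tnth s i), u (tnth s i)])
    (P.[t%:P].[tnth s i] * v (upd s i t)).

Definition within_box i (l u : R -> R) :=
  forall x, x \in `[a i, b i] -> a i <= l x /\ u x <= b i.

Lemma measurable_horner2r P (x : R) :
  measurable_fun setT (fun t : R => (P : {poly {poly R}}).[t%:P].[x]).
Proof. by apply: measurable_horner2 => //; exact: measurable_cst. Qed.

Lemma ae_kernel_integrable i (l u : R -> R) (P : {poly {poly R}}) v :
  within_box i l u -> sqr_int a b v -> {ae mu, forall s : Rn R N,
  leb.-integrable `[l (tnth s i), u (tnth s i)]
    (EFin \o (fun t => P.[t%:P].[tnth s i] * v (upd s i t)))}.
Proof.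
move=> lu v2; have [M PM] := horner2_bounded (a i) (b i) P.
apply: filterS2 (ae_box a b) (ae_slice_integrable i v2) => s sab iv.
have [al ub] := lu _ (sab i).
apply: (integrable_bounded_mul al ub (@measurable_horner2r P _) _ _ iv).
  by move=> t tab; apply: PM => //; exact: sab.
exact: measurable_slice v2.1.
Qed.

Lemma L2_bounded_kernel_op i (l u : R -> R) P :
  measurable_fun setT l -> measurable_fun setT u ->
  within_box i l u -> L2_bounded a b (kernel_op i l u P).
Proof.
move=> ml mmu lu.
have [M PM] := horner2_bounded (a i) (b i) P.
have mK v : measurable_fun setT v -> measurable_fun setT (kernel_op i l u P v).
  move=> mv; apply: (@measurable_Rintegral_itv _ _ _ (fun z =>
    P.[(z.2)%:P].[tnth z.1 i] * v (upd z.1 i z.2))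
    (fun s => l (tnth s i)) (fun s => u (tnth s i))).
  - apply: measurable_funM.
      by apply: measurable_horner2 => //; exact: measurable_coord.
    by apply: measurableT_comp => //; exact: measurable_upd.
  - by apply: measurableT_comp => //; exact: measurable_coord.
  - by apply: measurableT_comp => //; exact: measurable_coord.
split=> //.
- move=> c v w v2 w2.
  apply: filterS2 (ae_kernel_integrable P lu v2) (ae_kernel_integrable P lu w2) => s iv iw.
  rewrite /kernel_op -RintegralZl// -RintegralD//; last exact: (integrableZl _ c iv).
  by apply: eq_Rintegral => t _; rewrite mulrDr mulrCA.
- have L0 : 0 <= b i - a i by rewrite subr_ge0.
  have M0 : 0 <= M ^+ 2 * (b i - a i) by rewrite mulr_ge0// sqr_ge0.
  (* One factor [b i - a i] comes from Cauchy-Schwarz on the slice, the other from integrating the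
     slice norm, constant in [s_i], over the box. *)
  exists (M ^+ 2 * (b i - a i) * (b i - a i)).
    exact: mulr_ge0.
  move=> v v2; rewrite EFinM -muleA.
  have mv2 := measurable_fun_sqr v2.1.
  have v20 s : (0 <= (v s ^+ 2)%:E)%E by rewrite lee_fin sqr_ge0.
  have mphi := measurable_fun_slice_int a b i mv2 v20.
  rewrite -(ge0_integral_slice ab i mv2 v20) -ge0_integralZl//; last first.
    by move=> s _; apply: integral_ge0.
  apply: ae_ge0_le_integral => //.
  + by move=> s _; rewrite lee_fin sqr_ge0.
  + by apply: measurable_fun_sqr; apply: mK; case: v2.
  + move=> s _; rewrite mule_ge0//.
    exact: integral_ge0.
  + by apply: emeasurable_funM.
  apply: filterS2 (ae_box a b) (ae_slice ab i v2) => s sab soo _.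
  have [al ub] := lu _ (sab i).
  apply: (sqr_integral_mul_le (ab i) al ub (@measurable_horner2r P _) _
    (measurable_slice s i v2.1) soo).
  by move=> t tab; apply: PM => //; exact: sab.
Qed.

Lemma L2_bounded_mul (h : Rn R N -> R) (M : R) : measurable_fun setT h ->
  (forall s, box a b s -> `|h s| <= M) -> L2_bounded a b (fun v s => h s * v s).
Proof.
move=> mh hM; split.
- by move=> v mv; exact: measurable_funM.
- by move=> c v w _ _; apply: aeW => s; rewrite mulrDr mulrCA.
- exists (M ^+ 2); first exact: sqr_ge0.
  move=> v v2; have mv2 := measurable_fun_sqr v2.1.
  have v20 s : (0 <= (v s ^+ 2)%:E)%E by rewrite lee_fin sqr_ge0.
  rewrite /sqr_norm -ge0_integralZl// ?lee_fin ?sqr_ge0//.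
  apply: ae_ge0_le_integral => //.
  + by move=> s _; rewrite lee_fin sqr_ge0.
  + by apply: measurable_fun_sqr; apply: measurable_funM => //; case: v2.
  + by move=> s _; rewrite mule_ge0// lee_fin sqr_ge0.
  + exact: emeasurable_funM.
  apply: filterS (ae_box a b) => s sab _.
  rewrite -EFinM lee_fin exprMn ler_wpM2r ?sqr_ge0//.
  rewrite -[leLHS]real_normK ?num_real// ler_sqr ?nnegrE//; first exact: hM.
  by apply: le_trans (hM _ sab).
Qed.

Lemma lift_PI_opE i P0 P1 P2 v s :
  lift_op i (PI_op (a i) (b i) P0 P1 P2) v s =
  P0.[tnth s i] * v s + kernel_op i (fun=> a i) id P1 v s
    + kernel_op i id (fun=> b i) P2 v s.
Proof. by rewrite /lift_op /PI_op upd_id. Qed.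

Lemma L2_bounded_lift_PI_op i P0 P1 P2 :
  L2_bounded a b (lift_op i (PI_op (a i) (b i) P0 P1 P2)).
Proof.
rewrite (_ : lift_op _ _ = (fun v s =>
  (fun v s => P0.[tnth s i] * v s + kernel_op i (fun=> a i) id P1 v s) v s
    + kernel_op i id (fun=> b i) P2 v s)); last first.
  by apply/funext => v; apply/funext => s; rewrite lift_PI_opE.
have [M P0M] := horner_bounded (a i) (b i) P0.
apply: L2_boundedD; first apply: L2_boundedD.
- apply: (@L2_bounded_mul _ M).
    by apply: measurable_horner; exact: measurable_coord.
  by move=> s sab; apply: P0M; exact: sab.
- apply: L2_bounded_kernel_op => //.
  by move=> x; rewrite in_itv/= => /andP[].
- apply: L2_bounded_kernel_op => //.
  by move=> x; rewrite in_itv/= => /andP[].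
Qed.

End PI_bounded.

(** * Compositions of scalar PI operators over a list of variables *)

Section PI_sums.
Context (R : realType) (N : nat) (a b : 'I_N -> R).
Hypothesis ab : forall i, a i <= b i.
Local Notation mu := (lebesgue_box a b).
Local Notation leb := (@lebesgue_measure R).
Local Notation PI_data := ({poly R} * {poly {poly R}} * {poly {poly R}})%type.
Implicit Types (v : Rn R N -> R) (i : 'I_N) (r : seq 'I_N).

Definition lift_PI i (q : PI_data) : (Rn R N -> R) -> Rn R N -> R :=
  lift_op i (PI_op (a i) (b i) q.1.1 q.1.2 q.2).

(** Over [index_enum 'I_N] this is the composition that [PiN] asks for; arbitrary lists allow
    induction on the variables. *)
Definition comp_PI r (q : 'I_N -> PI_data) : (Rn R N -> R) -> Rn R N -> R :=
  \big[(fun f g => f \o g)/id]_(i <- r) lift_PI i (q i).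

Lemma comp_PI_cons i r q v : comp_PI (i :: r) q v = lift_PI i (q i) (comp_PI r q v).
Proof. by rewrite /comp_PI big_cons. Qed.

Lemma eq_comp_PI r q q' : {in r, q =1 q'} -> comp_PI r q = comp_PI r q'.
Proof. by move=> qq; apply: eq_big_seq => i /qq ->. Qed.

Lemma L2_bounded_lift_PI i q : L2_bounded a b (lift_PI i q).
Proof. exact: L2_bounded_lift_PI_op. Qed.

Lemma L2_bounded_comp_PI r q : L2_bounded a b (comp_PI r q).
Proof.
elim: r => [|i r IH]; rewrite /comp_PI ?big_nil ?big_cons.
  exact: L2_bounded_id.
exact: L2_bounded_comp (L2_bounded_lift_PI i (q i)) IH.
Qed.

Lemma ae_eq_sum (I : Type) (r : seq I) (f g : I -> Rn R N -> R) :
  (forall k, {ae mu, forall s : Rn R N, f k s = g k s}) ->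
  {ae mu, forall s : Rn R N, \sum_(k <- r) f k s = \sum_(k <- r) g k s}.
Proof.
move=> fg; elim: r => [|k r IH]; first by apply: aeW => s; rewrite !big_nil.
by apply: filterS2 (fg k) IH => s fgs IH; rewrite !big_cons fgs IH.
Qed.

(** The coefficient [p%:P] is constant in the integration variable, so the kernels are multiplied by
    [p] of the output variable. *)
Definition scale_PI (p : {poly R}) (q : PI_data) : PI_data :=
  (p * q.1.1, p%:P * q.1.2, p%:P * q.2).

(** Both [p] at [s_i] and [h], which is constant in direction [i], leave the integral. Later [h] is
    the product of the polynomial factors in the remaining variables. *)
Lemma ae_kernel_op_scale i (l u : R -> R) (p : {poly R}) P (h v : Rn R N -> R) :
  within_box a b i l u -> sqr_int a b v -> (forall s t, h (upd s i t) = h s) ->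
  {ae mu, forall s : Rn R N, kernel_op i l u (p%:P * P) (fun s => h s * v s) s =
    p.[tnth s i] * h s * kernel_op i l u P v s}.
Proof.
move=> lu v2 hi; have := ae_kernel_integrable ab P lu v2.
apply: filterS => s iv; rewrite /kernel_op -RintegralZl//.
apply: eq_Rintegral => t _.
by rewrite hornerM hornerC hornerM hi [LHS]mulrACA.
Qed.

Lemma ae_lift_PI_scale i (p : {poly R}) q (h v : Rn R N -> R) :
  sqr_int a b v -> (forall s t, h (upd s i t) = h s) ->
  {ae mu, forall s : Rn R N, lift_PI i (scale_PI p q) (fun s => h s * v s) s =
    p.[tnth s i] * h s * lift_PI i q v s}.
Proof.
move=> v2 hi.
have l1 : within_box a b i (fun=> a i) id.
  by move=> x; rewrite in_itv/= => /andP[].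
have l2 : within_box a b i id (fun=> b i).
  by move=> x; rewrite in_itv/= => /andP[].
apply: filterS2 (ae_kernel_op_scale p q.1.2 l1 v2 hi) (ae_kernel_op_scale p q.2 l2 v2 hi).
move=> s e1 e2; rewrite /lift_PI !lift_PI_opE/= e1 e2 hornerM !mulrDr.
by rewrite [X in X + _ + _]mulrACA.
Qed.

Lemma prod_coord_upd r i (p : 'I_N -> {poly R}) s t : i \notin r ->
  \prod_(j <- r) (p j).[tnth (upd s i t) j] = \prod_(j <- r) (p j).[tnth s j].
Proof.
move=> ir; apply: eq_big_seq => j jr; rewrite tnth_upd; case: eqP => // ji.
by move: ir; rewrite -ji jr.
Qed.

Lemma measurable_prod_coord r (p : 'I_N -> {poly R}) :
  measurable_fun setT (fun s : Rn R N => \prod_(j <- r) (p j).[tnth s j]).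
Proof.
elim: r => [|i r IH].
  by under eq_fun do rewrite big_nil; exact: measurable_cst.
under eq_fun do rewrite big_cons; apply: measurable_funM => //.
by apply: measurable_horner; exact: measurable_coord.
Qed.

Lemma ae_eq_sqr_int v w : measurable_fun setT v -> sqr_int a b w ->
  {ae mu, forall s : Rn R N, v s = w s} -> sqr_int a b v.
Proof.
by move=> mv [mw woo] vw; split => //; rewrite (ae_eq_sqr_norm mv mw vw).
Qed.

(** The factors already extracted from the tail do not involve [s_i], because the list is
    duplicate-free; hence they pass through the operator in variable [i]. *)
Lemma ae_comp_PI_scale r (p : 'I_N -> {poly R}) q v : uniq r -> sqr_int a b v ->
  {ae mu, forall s : Rn R N, comp_PI r (fun i => scale_PI (p i) (q i)) v s =
    \prod_(i <- r) (p i).[tnth s i] * comp_PI r q v s}.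
Proof.
move=> + v2; elim: r => [_|i r IH /= /andP[ir ur]].
  by apply: aeW => s; rewrite big_nil mul1r /comp_PI !big_nil.
have g2 := L2_bounded_sqr_int (L2_bounded_comp_PI r q) v2.
have gs2 := L2_bounded_sqr_int
  (L2_bounded_comp_PI r (fun i => scale_PI (p i) (q i))) v2.
(* Square integrability is inherited from the scaled composition, almost everywhere equal to this
   product, so the product of polynomials need not be bounded. *)
have hg2 : sqr_int a b
    (fun s => \prod_(j <- r) (p j).[tnth s j] * comp_PI r q v s).
  apply: (ae_eq_sqr_int _ gs2); last first.
    by apply: filterS (IH ur) => s ->.
  by apply: measurable_funM; [exact: measurable_prod_coord|case: g2].
have := ae_lift_PI_scale (p i) (q i) g2 (fun s t => prod_coord_upd p s t ir).
apply: filterS2 (L2_bounded_ae_eq (L2_bounded_lift_PI i (scale_PI (p i) (q i)))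
  gs2 hg2 (IH ur)) => s.
by rewrite !comp_PI_cons big_cons => -> ->.
Qed.

(** * Matrices of sums of compositions *)

Section vector_operators.
Context (n : nat).
Local Notation vec := (Rn R N -> 'cV[R]_n).
Implicit Types (w : vec) (P : vec -> vec).

Definition measurable_cV w := forall k, measurable_fun setT (fun s => w s k 0).

Definition sqr_int_cV w := forall k, sqr_int a b (fun s => w s k 0).

Lemma sqr_int_cV_measurable w : sqr_int_cV w -> measurable_cV w.
Proof. by move=> w2 k; case: (w2 k). Qed.

(** The list [q k l] holds the summands of entry (k, l), and [r] the variables composed so far. The
    first clause is not implied by the second, which determines [P w] only up to a null set. *)
Definition PI_mx r P :=
  (forall w, measurable_cV w -> measurable_cV (P w)) /\
  exists q : 'I_n -> 'I_n -> seq ('I_N -> PI_data),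
    forall w, sqr_int_cV w -> forall k, {ae mu, forall s : Rn R N, P w s k 0 =
      \sum_l \sum_(x <- q k l) comp_PI r x (fun s => w s l 0) s}.

Lemma sqr_int_sum_comp_PI r (q : 'I_n -> seq ('I_N -> PI_data)) w : sqr_int_cV w ->
  sqr_int a b (fun s => \sum_l \sum_(x <- q l) comp_PI r x (fun s => w s l 0) s).
Proof.
move=> w2; apply: (@sqr_int_sum _ _ _ _ _ _ (fun l s => \sum_(x <- q l) _)) => l.
apply: sqr_int_sum => x; apply: L2_bounded_sqr_int (w2 l).
exact: L2_bounded_comp_PI.
Qed.

Lemma PI_mx_sqr_int r P w : PI_mx r P -> sqr_int_cV w -> sqr_int_cV (P w).
Proof.
move=> [mP [q Pq]] w2 k; apply: ae_eq_sqr_int (Pq _ w2 k).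
  exact: mP (sqr_int_cV_measurable w2) k.
exact: sqr_int_sum_comp_PI.
Qed.

Lemma PI_mx_id : PI_mx [::] id.
Proof.
(* A composition over the empty list is the identity whatever data it carries, so one arbitrary
   summand on the diagonal suffices. *)
split=> //; exists (fun k l => if k == l then [:: fun=> (0, 0, 0)] else [::]).
move=> w w2 k; apply: aeW => s; rewrite (bigD1 k)//= eqxx big_seq1 big1 ?addr0.
  by rewrite /comp_PI big_nil.
by move=> l /negPf lk; rewrite eq_sym lk big_nil.
Qed.

(** A matrix product: entry (k, l') runs over the intermediate components l, prefixing the operator
    of [F] from l to k to each summand of [P] from l' to l. *)
Lemma PI_mx_cons i r (F P : vec -> vec) (f : 'I_n -> 'I_n -> PI_data) :
  i \notin r -> (forall w, measurable_cV w -> measurable_cV (F w)) ->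
  (forall w, sqr_int_cV w -> forall k, {ae mu, forall s : Rn R N,
     F w s k 0 = \sum_l lift_PI i (f k l) (fun s => w s l 0) s}) ->
  PI_mx r P -> PI_mx (i :: r) (F \o P).
Proof.
move=> ir mF Ff PP; have [mP [q Pq]] := PP.
split=> [w mw|]; first by apply: mF; exact: mP.
(* Overwriting the datum at [i] does not affect the composition over [r], as [i] is not in [r]. *)
pose put (c : PI_data) x (j : 'I_N) := if j == i then c else x j : PI_data.
exists (fun k l' => flatten
  [seq [seq put (f k l) x | x <- q l l'] | l <- index_enum 'I_n]).
move=> w w2 k.
have Pw2 := PI_mx_sqr_int PP w2.
have E l : {ae mu, forall s : Rn R N, lift_PI i (f k l) (fun s => P w s l 0) s =
    \sum_l' \sum_(x <- q l l') comp_PI (i :: r) (put (f k l) x) (fun s => w s l' 0) s}.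
  have LL := L2_bounded_lift_PI i (f k l).
  have c2 x l' : sqr_int a b (comp_PI r x (fun s => w s l' 0)).
    by apply: L2_bounded_sqr_int (w2 l'); exact: L2_bounded_comp_PI.
  (* [e1] substitutes the expansion of [P w] under the operator; [e2] and [e3] distribute the
     operator over the outer and inner sums. *)
  have e1 := L2_bounded_ae_eq LL (Pw2 l) (sqr_int_sum_comp_PI r (q l) w2) (Pq _ w2 l).
  have e2 := L2_bounded_ae_sum (index_enum 'I_n)
    (f := fun l' s => \sum_(x <- q l l') comp_PI r x (fun s => w s l' 0) s) LL
    (fun l' => sqr_int_sum (q l l') (fun x => c2 x l')).
  have e3 : {ae mu, forall s : Rn R N, forall l' : 'I_n,
      lift_PI i (f k l) (fun s => \sum_(x <- q l l') comp_PI r x (fun s => w s l' 0) s) s =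
      \sum_(x <- q l l') lift_PI i (f k l) (comp_PI r x (fun s => w s l' 0)) s}.
    by apply: filter_forall => l'; exact: L2_bounded_ae_sum.
  apply: filterS3 e1 e2 e3 => s -> -> e3; apply: eq_bigr => l' _.
  rewrite e3; apply: eq_bigr => x _; rewrite comp_PI_cons /put eqxx.
  congr (lift_PI _ _ (_ _) _); apply: eq_comp_PI => j jr.
  by case: eqP => // ji; move: ir; rewrite -ji jr.
have E' : {ae mu, forall s : Rn R N, forall l,
    lift_PI i (f k l) (fun s => P w s l 0) s =
    \sum_l' \sum_(x <- q l l') comp_PI (i :: r) (put (f k l) x) (fun s => w s l' 0) s}.
  exact: filter_forall.
apply: filterS2 (Ff _ Pw2 k) E' => s /= -> {}E'.
rewrite (eq_bigr _ (fun l _ => E' l)) exchange_big/=; apply: eq_bigr => l' _.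
by rewrite big_flatten/= big_map; apply: eq_bigr => l _; rewrite big_map.
Qed.

Lemma PI_mx_sum r (I : finType) (P : I -> vec -> vec) :
  (forall al, PI_mx r (P al)) -> PI_mx r (fun w s => \sum_al P al w s).
Proof.
move=> PP; split=> [w mw k|].
  under eq_fun do rewrite summxE.
  by apply: measurable_sum => al; exact: (PP al).1.
have /choice [q Pq] := fun al => (PP al).2.
exists (fun k l => flatten [seq q al k l | al <- index_enum I]) => w w2 k.
have E : {ae mu, forall s : Rn R N, forall al, P al w s k 0 =
    \sum_l \sum_(x <- q al k l) comp_PI r x (fun s => w s l 0) s}.
  by apply: filter_forall => al; exact: Pq.
apply: filterS E => s E; rewrite summxE (eq_bigr _ (fun al _ => E al)).
by rewrite exchange_big/=; apply: eq_bigr => l _; rewrite big_flatten/= big_map.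
Qed.

Lemma measurable_meval (p : mpoly.mpoly N R) :
  measurable_fun setT (fun s : Rn R N => mpoly.meval (tnth s) p).
Proof.
under eq_fun do rewrite mpoly.mevalE.
apply: measurable_sum => m; apply: measurable_funM; first exact: measurable_cst.
under eq_fun do under eq_bigr do rewrite -hornerXn.
exact: (measurable_prod_coord _ (fun j => 'X^(mpoly.fun_of_multinom m j))).
Qed.

(** Stated for the full list of variables, so that every power of a coordinate in a monomial meets
    an operator in that same coordinate. *)
Lemma PI_mx_mult_op (A : 'M[mpoly.mpoly N R]_n) P : (0 < N)%N ->
  PI_mx (index_enum 'I_N) P -> PI_mx (index_enum 'I_N) (mult_op A \o P).
Proof.
move=> N0 PP; have [mP [q Pq]] := PP; split=> [w mw k|].
  rewrite (_ : (fun _ => _) =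
      (fun s => \sum_l mpoly.meval (tnth s) (A k l) * P w s l 0)); last first.
    by apply/funext => s; rewrite /= mxE; apply: eq_bigr => l _; rewrite mxE.
  apply: measurable_sum => l; apply: measurable_funM; first exact: measurable_meval.
  exact: mP.
pose i0 := Ordinal N0.
(* The coefficient of a monomial is absorbed by the operator in variable i0. *)
pose mon l k m (i : 'I_N) : {poly R} :=
  (if i == i0 then mpoly.mcoeff m (A k l) else 1)%:P * 'X^(mpoly.fun_of_multinom m i).
have monE l k m (s : Rn R N) : \prod_i (mon l k m i).[tnth s i] =
    mpoly.mcoeff m (A k l) * \prod_i tnth s i ^+ mpoly.fun_of_multinom m i.
  under eq_bigr do rewrite hornerM hornerC hornerXn.
  rewrite big_split/=; congr (_ * _); rewrite (bigD1 i0)//= ?eqxx big1 ?mulr1//.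
  by move=> i /negPf ->.
pose scale p (x : 'I_N -> PI_data) i := scale_PI (p i) (x i).
exists (fun k l' => flatten [seq flatten
  [seq [seq scale (mon l k m) x | x <- q l l'] | m <- mpoly.msupp (A k l)]
    | l <- index_enum 'I_n]).
move=> w w2 k.
have E : {ae mu, forall s : Rn R N, forall l, P w s l 0 =
      \sum_l' \sum_(x <- q l l') comp_PI (index_enum 'I_N) x (fun s => w s l' 0) s}.
  by apply: filter_forall => l; exact: Pq.
have E2 : {ae mu, forall s : Rn R N, forall l' l,
   \sum_(m <- mpoly.msupp (A k l)) \sum_(x <- q l l')
     comp_PI (index_enum 'I_N) (scale (mon l k m) x) (fun s => w s l' 0) s =
   \sum_(m <- mpoly.msupp (A k l)) \sum_(x <- q l l')
     \prod_i (mon l k m i).[tnth s i] *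
       comp_PI (index_enum 'I_N) x (fun s => w s l' 0) s}.
  apply: filter_forall => l'; apply: filter_forall => l.
  apply: (@ae_eq_sum _ _ (fun m s => \sum_(x <- q l l') _)
    (fun m s => \sum_(x <- q l l') _)) => m.
  apply: ae_eq_sum => x; apply: ae_comp_PI_scale => //.
  exact: index_enum_uniq.
apply: filterS2 E E2 => s E E2; rewrite /= mxE.
transitivity (\sum_l \sum_l' \sum_(m <- mpoly.msupp (A k l)) \sum_(x <- q l l')
     comp_PI (index_enum 'I_N) (scale (mon l k m) x) (fun s => w s l' 0) s).
  apply: eq_bigr => l _; rewrite mxE E mulr_sumr; apply: eq_bigr => l' _.
  rewrite E2 mpoly.mevalE mulr_suml; apply: eq_bigr => m _.
  by rewrite mulr_sumr; apply: eq_bigr => x _; rewrite monE.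
rewrite exchange_big/=; apply: eq_bigr => l' _.
rewrite big_flatten/= big_map; apply: eq_bigr => l _.
by rewrite big_allpairs_dep.
Qed.

Lemma L2P w : L2 a b w <-> sqr_int_cV w.
Proof. by split=> w2 k; apply/Lfun2P; exact: w2. Qed.

(** Controls one row of a matrix of operators by the full vector norm, adding one column at a time
    with the factor 2 of [sqr_norm_lin]. *)
Lemma sqr_norm_sum_bound (r : seq 'I_n) (G : 'I_n -> (Rn R N -> R) -> Rn R N -> R) :
  (forall l, L2_bounded a b (G l)) -> exists2 c : R, 0 <= c &
  forall w, sqr_int_cV w ->
  (sqr_norm a b (fun s => \sum_(l <- r) G l (fun s => w s l 0)%R s)%R <=
   c%:E * \sum_l sqr_norm a b (fun s => w s l 0)%R)%E.
Proof.
move=> LG; elim: r => [|l r [c c0 IH]].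
  exists 0 => // w w2; rewrite mul0e; under eq_fun do rewrite big_nil.
  by rewrite sqr_norm0.
have [mG _ [d d0 Gd]] := LG l.
exists (2 * d + 2 * c); first by rewrite addr_ge0// mulr_ge0.
move=> w w2; have S0 (r' : seq 'I_n) Q :
    (0 <= \sum_(j <- r' | Q j) sqr_norm a b (fun s => w s j 0%R))%E.
  by apply: sume_ge0 => j _; exact: sqr_norm_ge0.
have G2 : sqr_int a b (fun s => \sum_(j <- r) G j (fun s => w s j 0) s).
  by apply: sqr_int_sum => j; exact: L2_bounded_sqr_int (w2 j).
have := sqr_norm_lin a b 1 (mG _ (w2 l).1) G2.1.
rewrite (_ : (fun _ => _) = (fun s => \sum_(j <- l :: r) G j (fun s => w s j 0) s));
  last by apply/funext => s; rewrite mul1r big_cons.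
move=> /le_trans; apply; rewrite expr1n mulr1 (EFinD (2 * d)).
rewrite ge0_muleDl ?lee_fin ?mulr_ge0// leeD// (EFinM 2) -muleA lee_wpmul2l//; last exact: IH.
rewrite (le_trans (Gd _ (w2 l)))// lee_wpmul2l// ?lee_fin//.
by rewrite (bigD1 l)//= leeDl.
Qed.

Lemma sqr_L2norm w : sqr_int_cV w ->
  L2norm a b w = Num.sqrt (fine (\sum_k sqr_norm a b (fun s => w s k 0)%R)%E).
Proof.
move=> w2; rewrite /L2norm /Rintegral; congr (Num.sqrt (fine _)).
rewrite -ge0_integral_sum//.
- by apply: eq_integral => s _; rewrite sumEFin.
- by move=> k; apply: measurable_fun_sqr; case: (w2 k).
- by move=> k s _; rewrite lee_fin sqr_ge0.
Qed.

Lemma fin_num_sum_sqr_norm w : sqr_int_cV w ->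
  (\sum_k sqr_norm a b (fun s => w s k 0)%R)%E \is a fin_num.
Proof.
move=> w2; rewrite ge0_fin_numE; last by apply: sume_ge0 => k _; exact: sqr_norm_ge0.
by apply/lte_sum_pinfty => k _; case: (w2 k).
Qed.

Lemma cV_ext (u v : 'cV[R]_n) : (forall k, u k 0 = v k 0) -> u = v.
Proof. by move=> uv; apply/matrixP => k j; rewrite (ord1 j). Qed.

Lemma PI_mx_bounded r P : PI_mx r P -> bounded_operator a b P.
Proof.
move=> PP; have [mP [q Pq]] := PP; split.
- by move=> w /L2P w2; apply/L2P; exact: PI_mx_sqr_int PP w2.
- move=> v w /L2P v2 /L2P w2 vw.
  have E : {ae mu, forall s : Rn R N, forall k, P v s k 0 = P w s k 0}.
    apply: filter_forall => k.
    have eqvw : {ae mu, forall s : Rn R N,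
       \sum_l \sum_(x <- q k l) comp_PI r x (fun s => v s l 0) s =
       \sum_l \sum_(x <- q k l) comp_PI r x (fun s => w s l 0) s}.
      apply: (@ae_eq_sum _ _ (fun l s => \sum_(x <- q k l) _)
        (fun l s => \sum_(x <- q k l) _)) => l.
      apply: ae_eq_sum => x; apply: L2_bounded_ae_eq (v2 l) (w2 l) _.
        exact: L2_bounded_comp_PI.
      by apply: filterS vw => s ->.
    by apply: filterS3 (Pq _ v2 k) (Pq _ w2 k) eqvw => s -> ->.
  by apply: filterS E => s E; exact: cV_ext.
- move=> c v w /L2P v2 /L2P w2.
  have u2 : sqr_int_cV (fun s => c *: v s + w s).
    move=> k; under eq_fun do rewrite !mxE; exact: sqr_int_lin (v2 k) (w2 k).
  have E : {ae mu, forall s : Rn R N, forall k,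
      P (fun s => c *: v s + w s) s k 0 = c * P v s k 0 + P w s k 0}.
    apply: filter_forall => k.
    have lin : {ae mu, forall s : Rn R N,
       \sum_l \sum_(x <- q k l) comp_PI r x (fun s => (c *: v s + w s) l 0) s =
       \sum_l \sum_(x <- q k l) (c * comp_PI r x (fun s => v s l 0) s
                                  + comp_PI r x (fun s => w s l 0) s)}.
      apply: (@ae_eq_sum _ _ (fun l s => \sum_(x <- q k l) _)
        (fun l s => \sum_(x <- q k l) _)) => l.
      apply: ae_eq_sum => x; have [_ linx _] := L2_bounded_comp_PI r x.
      have := linx c _ _ (v2 l) (w2 l); apply: filterS => s <-.
      by congr (comp_PI _ _ _ _); apply/funext => s'; rewrite !mxE.
    have Pu : {ae mu, forall s : Rn R N, P (fun s => c *: v s + w s) s k 0 =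
       \sum_l \sum_(x <- q k l) (c * comp_PI r x (fun s => v s l 0) s
                                  + comp_PI r x (fun s => w s l 0) s)}.
      by apply: filterS2 (Pq _ u2 k) lin => s -> ->.
    apply: filterS3 Pu (Pq _ v2 k) (Pq _ w2 k) => s -> -> ->.
    rewrite mulr_sumr -big_split/=; apply: eq_bigr => l _.
    by rewrite big_split/= mulr_sumr.
  by apply: filterS E => s E; apply: cV_ext => k; rewrite E !mxE.
- have /choice[c cP] : forall k, exists c : R, 0 <= c /\ forall w, sqr_int_cV w ->
      (sqr_norm a b (fun s => P w s k 0)%R <=
       c%:E * \sum_l sqr_norm a b (fun s => w s l 0)%R)%E.
    move=> k; have [c c0 cP] := sqr_norm_sum_bound (index_enum 'I_n)
      (fun l => L2_bounded_sum (q k l) (fun x => L2_bounded_comp_PI r x)).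
    exists c; split => // w w2; rewrite (ae_eq_sqr_norm _ _ (Pq _ w2 k)); first exact: cP.
      exact: mP (sqr_int_cV_measurable w2) k.
    by case: (sqr_int_sum_comp_PI r (q k) w2).
  (* Row k contributes at most [c k] times the squared norm; the rows are added before the square
     root is taken. *)
  exists (Num.sqrt (\sum_k c k)) => w /L2P w2.
  have C0 : 0 <= \sum_k c k by apply: sumr_ge0 => k _; case: (cP k).
  have Pw2 := PI_mx_sqr_int PP w2.
  rewrite !sqr_L2norm// -sqrtrM// ler_wsqrtr// -lee_fin EFinM.
  rewrite !fineK ?fin_num_sum_sqr_norm//.
  rewrite -sumEFin ge0_sume_distrl; last by move=> k _; rewrite lee_fin; case: (cP k).
  by apply: lee_sum => k _; case: (cP k) => _; exact.
Qed.

(** The entry operator feeds [v] into component [l] and zero elsewhere; the other columns vanish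
    almost everywhere by linearity. *)
Lemma PI_mx_PiN_mx P : PI_mx (index_enum 'I_N) P -> PiN_mx a b P.
Proof.
move=> PP; split; first exact: PI_mx_bounded PP.
have [mP [q Pq]] := PP => k l.
(* Default for [nth], never read since the index stays below the size. *)
pose x0 (i : 'I_N) : PI_data := (0, 0, 0).
exists (size (q k l)), (fun j i =>
  let x := nth x0 (q k l) j i in PI_op (a i) (b i) x.1.1 x.1.2 x.2).
split=> [j i|v /Lfun2P v2]; first by do 3 eexists.
pose w (s : Rn R N) : 'cV[R]_n := v s *: delta_mx l 0.
have wl : (fun s => w s l 0) = v.
  by apply/funext => s; rewrite !mxE !eqxx mulr1.
have wl' l' : l' != l -> (fun s => w s l' 0) = fun=> 0.
  by move=> /negPf l'l; apply/funext => s; rewrite !mxE l'l mulr0.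
have w2 : sqr_int_cV w.
  by move=> l'; have [->|/wl' ->] := eqVneq l' l; rewrite ?wl//; exact: sqr_int0.
have E : {ae mu, forall s : Rn R N, forall l', l' != l ->
    \sum_(x <- q k l') comp_PI (index_enum 'I_N) x (fun s => w s l' 0) s = 0}.
  apply: filter_forall => l'; have [->|l'l] := eqVneq l' l; first exact: aeW.
  have := L2_bounded_ae0 (L2_bounded_sum (q k l')
    (fun x => L2_bounded_comp_PI (index_enum 'I_N) x)).
  by apply: filterS => s; rewrite wl'.
apply: filterS2 (Pq _ w2 k) E => s Pqs E; rewrite /op_entry -/(w _) Pqs.
rewrite (bigD1 l)//= [X in _ + X]big1; last exact: E.
rewrite addr0 wl (big_nth x0) big_mkord.
by apply: eq_bigr.
Qed.

End vector_operators.
End PI_sums.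

(** * Polynomiality of the kernels built from E_1, K and E_d *)

Section polynomial_kernels.
Context (R : realType).

Definition horner_mx m n (P : 'M[{poly R}]_(m, n)) (z : R) : 'M[R]_(m, n) :=
  map_mx (fun p => p.[z]) P.

Lemma derive1_horner_mx m n (P : 'M[{poly R}]_(m, n)) :
  derive1 (horner_mx P) = horner_mx (map_mx (fun p => p^`()) P).
Proof.
have E i j : (fun z => horner_mx P z i j) = horner (P i j).
  by apply/funext => z; rewrite mxE.
apply/funext => z; rewrite derive1E derive_mx; last first.
  by apply/derivable_mxP => i j; rewrite E; exact: derivable_horner.
apply/matrixP => i j; rewrite !mxE E.
exact: (@derive_val _ _ _ _ _ _ _ (is_derive_poly (P i j) z)).
Qed.

(** Polynomial matrices are stable under differentiation, so only [E1_mx] itself needs an explicit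
    witness. *)
Lemma derive1n_E1_mx n d j : exists P, derive1n j (@E1_mx R n d) = horner_mx P.
Proof.
elim: j => [|j [P IH]]; last first.
  by rewrite derive1nS IH derive1_horner_mx; eexists.
(* [tagnat.sig1 k] is the block containing row [k] and [tagnat.sig2 k] the position inside it; each
   block is a scalar matrix. *)
exists (\matrix_(k < \sum_(i < d) n, l < n) ((((tagnat.sig1 k)`!)%:R^-1)%:P * 'X^(tagnat.sig1 k) *+
  ((tagnat.sig2 k : 'I_n) == l))).
rewrite derive1n0; apply/funext => z; apply/matrixP => k l; rewrite !mxE.
by rewrite hornerMn hornerM hornerC hornerXn mulrC.
Qed.

Lemma Ed_mx_horner n d : exists P, @Ed_mx R n d = horner_mx P.
Proof.
exists (\matrix_(k < \sum_(i < d) n, l < n) ((((d.-1 - tagnat.sig1 k)`!)%:R^-1)%:P *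
  'X^(d.-1 - tagnat.sig1 k) *+ ((tagnat.sig2 k : 'I_n) == l))).
apply/funext => z; apply/matrixP => k l; rewrite !mxE.
by rewrite hornerMn hornerM hornerC hornerXn mulrC.
Qed.

Definition bipolynomial (f : R -> R -> R) :=
  exists P : {poly {poly R}}, forall s t, f s t = P.[t%:P].[s].

Lemma bipolynomial_horner_sub (p : {poly R}) x :
  bipolynomial (fun s _ => p.[s - x]).
Proof.
exists (p \Po ('X - x%:P))%:P => s t.
by rewrite hornerC horner_comp hornerXsubC.
Qed.

Lemma bipolynomial_horner_rsub (p : {poly R}) x :
  bipolynomial (fun _ t => p.[x - t]).
Proof.
(* A function of [t] alone is a polynomial in the outer variable with constant coefficients; a
   function of [s] alone is a constant of the outer ring. *)
exists (map_poly polyC (p \Po (x%:P - 'X))) => s t.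
by rewrite horner_map hornerC horner_comp !hornerE.
Qed.

Lemma bipolynomialM f g : bipolynomial f -> bipolynomial g ->
  bipolynomial (fun s t => f s t * g s t).
Proof.
by move=> [P fP] [Q gQ]; exists (P * Q) => s t; rewrite fP gQ !hornerM.
Qed.

Lemma bipolynomial_cst c : bipolynomial (fun _ _ => c).
Proof. by exists c%:P%:P => s t; rewrite !hornerC. Qed.

Lemma bipolynomial_sum (I : finType) (f : I -> R -> R -> R) :
  (forall i, bipolynomial (f i)) -> bipolynomial (fun s t => \sum_i f i s t).
Proof.
move=> /choice[P fP]; exists (\sum_i P i) => s t.
by rewrite !horner_sum; apply: eq_bigr => i _; rewrite fP.
Qed.

Lemma bipolynomial_subX e : bipolynomial (fun s t => (s - t) ^+ e / (e`!)%:R).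
Proof.
(* The embedded inner variable stands for [s], the outer one for [t]. *)
exists ((('X : {poly R})%:P - 'X) ^+ e * (((e`!)%:R^-1)%:P)%:P) => s t.
rewrite hornerM hornerM horner_exp horner_exp !hornerC; congr (_ ^+ _ * _).
by rewrite hornerD hornerN hornerC hornerX hornerD hornerN hornerX hornerC.
Qed.

Lemma bipolynomial_A_kernel n d (a b : R) (K : 'M[R]_(\sum_(j < d) n)) j k l :
  bipolynomial (fun s t =>
    ((derive1n j (@E1_mx R n d) (s - a))^T *m K *m Ed_mx n d (b - t)) k l).
Proof.
have [P ->] := derive1n_E1_mx n d j; have [Q ->] := Ed_mx_horner n d.
rewrite (_ : (fun _ => _) = fun s t =>
  \sum_y (\sum_x (P x k).[s - a] * K x y) * (Q y l).[b - t]); last first.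
  apply/funext => s; apply/funext => t; rewrite mxE; apply: eq_bigr => y _.
  rewrite !mxE; congr (_ * _); apply: eq_bigr => x _; by rewrite !mxE.
apply: bipolynomial_sum => y; apply: bipolynomialM; last exact: bipolynomial_horner_rsub.
apply: bipolynomial_sum => x; apply: bipolynomialM; last exact: bipolynomial_cst.
exact: bipolynomial_horner_sub.
Qed.

End polynomial_kernels.

Lemma Rintegral_sum d (T : measurableType d) (R : realType)
    (m : {measure set T -> \bar R}) (D : set T) (I : Type) (r : seq I)
    (f : I -> T -> R) : measurable D ->
  (forall k, m.-integrable D (EFin \o f k)) ->
  \int[m]_(x in D) (\sum_(k <- r) f k x) = \sum_(k <- r) \int[m]_(x in D) f k x.
Proof.
move=> mD fi; rewrite /Rintegral.
under eq_integral do rewrite -sumEFin.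
rewrite integral_sum// -sum_fine// => k _; exact: integrable_fin_num (fi k).
Qed.

(** * The operators A_{i,j} as matrices of PI operators *)

Section A_operators.
Context (R : realType) (n N : nat) (a b : 'I_N -> R).
Hypothesis ab : forall i, a i <= b i.
Local Notation mu := (lebesgue_box a b).
Local Notation leb := (@lebesgue_measure R).
Context (delta : 'I_N -> nat).
Variables B C : forall i, 'I_(delta i) -> 'I_(delta i) -> 'M[R]_n.
Implicit Types w : Rn R N -> 'cV[R]_n.

Lemma A_op_lift_PI i j :
  (forall w, measurable_cV w -> measurable_cV (A_op a b B C i j w)) /\
  exists f : 'I_n -> 'I_n -> ({poly R} * {poly {poly R}} * {poly {poly R}})%type,
  forall w, sqr_int_cV a b w -> forall k, {ae mu, forall s : Rn R N,
     A_op a b B C i j w s k 0 = \sum_l lift_PI a b i (f k l) (fun s => w s l 0) s}.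
Proof.
case: (ltnP j (delta i)) => jd; last first.
  have AE w : A_op a b B C i j w = w.
    by apply/funext => s; rewrite /A_op /lift_op /A_univ ltnNge jd/= upd_id.
  split=> [w|]; first by rewrite AE.
  (* The identity is pure multiplication by the Kronecker delta. *)
  exists (fun k l => ((k == l)%:R%:P, 0, 0)) => w w2 k; apply: aeW => s.
  have z0 l u (v : Rn R N -> R) : kernel_op i l u 0 v s = 0.
    rewrite /kernel_op; under eq_Rintegral do rewrite !horner0 mul0r.
    by rewrite Rintegral_cst// mul0r.
  rewrite AE (bigD1 k)//= big1 => [|l /negPf lk];
    rewrite /lift_PI lift_PI_opE/= !z0 hornerC !addr0 ?eqxx ?mul1r//.
  by rewrite eq_sym lk mul0r.
pose e := ((delta i).-1 - j)%N.
have [c cE] := bipolynomial_subX R e.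
have /choice[M' ME'] : forall kl : 'I_n * 'I_n, exists P : {poly {poly R}}, forall s t,
    ((derive1n j (@E1_mx R n (delta i)) (s - a i))^T
      *m K_mx (a i) (b i) (@B i) (@C i) *m Ed_mx n (delta i) (b i - t)) kl.1 kl.2
    = P.[t%:P].[s].
  by move=> [k l]; exact: bipolynomial_A_kernel.
pose M k l := M' (k, l).
have AE w s k : A_op a b B C i j w s k 0 =
   kernel_op i (fun=> a i) id c (fun s => w s k 0) s -
   \int[leb]_(t in `[a i, b i]) (\sum_l (M k l).[t%:P].[tnth s i] * w (upd s i t) l 0).
  rewrite /A_op /lift_op /A_univ jd !mxE; congr (_ - _).
    by apply: eq_Rintegral => t _; rewrite !mxE cE.
  apply: eq_Rintegral => t _; rewrite mxE; apply: eq_bigr => l _.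
  by rewrite (ME' (k, l)).
split=> [w mw k|].
  under eq_fun do rewrite AE; apply: measurable_funB.
    apply: (@measurable_Rintegral_itv _ _ _ (fun z =>
      c.[(z.2)%:P].[tnth z.1 i] * w (upd z.1 i z.2) k 0)
      (fun s => a i) (fun s => tnth s i)) => //; last exact: measurable_coord.
    apply: measurable_funM.
      by apply: measurable_horner2 => //; exact: measurable_coord.
    by apply: (measurableT_comp (mw k)); exact: measurable_upd.
  apply: (@measurable_Rintegral_itv _ _ _ (fun z =>
      \sum_l (M k l).[(z.2)%:P].[tnth z.1 i] * w (upd z.1 i z.2) l 0)
      (fun s => a i) (fun s => b i)) => //.
  apply: measurable_sum => l; apply: measurable_funM.
    by apply: measurable_horner2 => //; exact: measurable_coord.
  by apply: (measurableT_comp (mw l)); exact: measurable_upd.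
(* The kernel [c] acts diagonally and only up to [s_i]. The integral with kernel [M] covers the
   whole interval, so [M] is subtracted on both sides of [s_i]. *)
exists (fun k l => (0, (if k == l then c else 0) - M k l, - M k l)) => w w2 k.
have wb1 : within_box a b i (fun=> a i) id.
  by move=> x; rewrite in_itv/= => /andP[].
have wb2 : within_box a b i id (fun=> b i).
  by move=> x; rewrite in_itv/= => /andP[].
have wb3 : within_box a b i (fun=> a i) (fun=> b i) by [].
have I1 : {ae mu, forall s : Rn R N, leb.-integrable `[a i, tnth s i]
    (EFin \o (fun t => c.[t%:P].[tnth s i] * w (upd s i t) k 0))}.
  exact: (ae_kernel_integrable ab c wb1 (w2 k)).
have I2 : {ae mu, forall s : Rn R N, forall l, leb.-integrable `[a i, b i]
    (EFin \o (fun t => (M k l).[t%:P].[tnth s i] * w (upd s i t) l 0))}.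
  apply: filter_forall => l; exact: (ae_kernel_integrable ab (M k l) wb3 (w2 l)).
apply: filterS3 (ae_box a b) I1 I2 => s sab I1 I2.
have /andP[asi sib] : a i <= tnth s i <= b i by have := sab i; rewrite in_itv.
rewrite AE.
have -> : \int[leb]_(t in `[a i, b i])
    (\sum_l (M k l).[t%:P].[tnth s i] * w (upd s i t) l 0) =
  \sum_l (kernel_op i (fun=> a i) id (M k l) (fun s => w s l 0) s +
          kernel_op i id (fun=> b i) (M k l) (fun s => w s l 0) s).
  transitivity (\sum_l \int[leb]_(t in `[a i, b i])
     ((M k l).[t%:P].[tnth s i] * w (upd s i t) l 0)).
    exact: Rintegral_sum.
  apply: eq_bigr => l _.
  (* Removing [[a_i, s_i]] leaves an interval open at [s_i]; closing it adds a single point, which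
     is null. *)
  have := @Rintegral_itvB _ _ (BLeft (a i)) (BRight (b i)) (tnth s i) (I2 l).
  rewrite !bnd_simp => /(_ asi sib) h.
  rewrite /kernel_op/= -(@Rintegral_itv_obnd_cbnd _ (tnth s i)).
    by rewrite -h addrC subrK.
  by apply: integrableS (I2 l) => //; apply: subset_itvr; rewrite bnd_simp.
have z0 l u (v : Rn R N -> R) : kernel_op i l u 0 v s = 0.
  rewrite /kernel_op; under eq_Rintegral do rewrite !horner0 mul0r.
  by rewrite Rintegral_cst// mul0r.
(* Additivity in the kernel needs both integrals to exist, hence the integrability facts at this [s]
   that follow. *)
have kB l u (P Q : {poly {poly R}}) (v : Rn R N -> R) :
    leb.-integrable `[l (tnth s i), u (tnth s i)]
      (EFin \o (fun t => P.[t%:P].[tnth s i] * v (upd s i t))) ->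
    leb.-integrable `[l (tnth s i), u (tnth s i)]
      (EFin \o (fun t => Q.[t%:P].[tnth s i] * v (upd s i t))) ->
    kernel_op i l u (P - Q) v s = kernel_op i l u P v s - kernel_op i l u Q v s.
  move=> iP iQ; rewrite /kernel_op -RintegralB//; apply: eq_Rintegral => t _.
  by rewrite !(hornerD, hornerN) mulrDl mulNr.
have i0 D (v : Rn R N -> R) : measurable D -> leb.-integrable D
    (EFin \o (fun t => (0 : {poly {poly R}}).[t%:P].[tnth s i] * v (upd s i t))).
  move=> mD; apply: eq_integrable (integrable0 _ _) => //.
  by move=> t _ /=; rewrite !horner0 mul0r.
have iM (l' u' : R) l : a i <= l' -> u' <= b i -> leb.-integrable `[l', u']
    (EFin \o (fun t => (M k l).[t%:P].[tnth s i] * w (upd s i t) l 0)).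
  move=> al ub; apply: integrableS (I2 l) => // t /=; rewrite !in_itv/=.
  by move=> /andP[lt tu]; rewrite (le_trans al lt) (le_trans tu ub).
transitivity (\sum_l (kernel_op i (fun=> a i) id (if k == l then c else 0)
    (fun s => w s l 0) s - (kernel_op i (fun=> a i) id (M k l) (fun s => w s l 0) s +
          kernel_op i id (fun=> b i) (M k l) (fun s => w s l 0) s))).
  rewrite sumrB; congr (_ - _); rewrite (bigD1 k)//= eqxx big1 ?addr0// => l.
  by rewrite eq_sym => /negPf ->; exact: z0.
apply: eq_bigr => l _; rewrite /lift_PI lift_PI_opE/= horner0 mul0r add0r.
have -> : kernel_op i id (fun=> b i) (- M k l) (fun s => w s l 0) s =
    - kernel_op i id (fun=> b i) (M k l) (fun s => w s l 0) s.
  by rewrite -[- M k l]sub0r kB ?z0 ?sub0r//; [exact: (i0 _ (fun s => w s l 0))|exact: iM].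
rewrite kB; first by rewrite opprD addrA.
  by case: eqP => [<-//|_]; exact: (i0 _ (fun s => w s l 0)).
exact: iM.
Qed.

Lemma PI_mx_comp_A_op (al : 'I_N -> nat) r : uniq r ->
  PI_mx a b r (\big[(fun f g => f \o g)/id]_(i <- r) A_op a b B C i (al i)).
Proof.
elim: r => [_|i r IH /= /andP[ir ur]]; first by rewrite big_nil; exact: PI_mx_id.
have [mA [f Af]] := A_op_lift_PI i (al i).
by rewrite big_cons; apply: (PI_mx_cons ab ir mA Af); exact: IH.
Qed.

End A_operators.

Theorem lemma25 (R : realType) (n N : nat) (a b : 'I_N -> R)
    (delta : 'I_N -> nat)
    (B C : forall i : 'I_N, 'I_(delta i) -> 'I_(delta i) -> 'M[R]_n)
    (D : 'I_N -> set (Rn R N -> 'cV[R]_n))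
    (A : {dffun forall i : 'I_N, 'I_(delta i).+1} -> 'M[mpoly.mpoly N R]_n) :
  (0 < n)%N -> (0 < N)%N ->
  (forall i, a i <= b i) ->
  (forall i, D i = lifted_domain a b i (B i) (C i)) ->
  (forall i, admissible (a i) (b i) (B i) (C i)) ->
  consistent a b B C ->
  PiN_mx a b (calT a b B C) /\ PiN_mx a b (calA a b B C A).
Proof.
move=> _ N0 ab _ _ _.
have PIA al : PI_mx a b (index_enum 'I_N) (comp_ops (fun i => A_op a b B C i (al i))).
  exact/PI_mx_comp_A_op/index_enum_uniq.
split; apply: (PI_mx_PiN_mx ab); first exact: (PIA (fun=> 0%N)).
by apply: (PI_mx_sum) => al; exact: (PI_mx_mult_op ab (A al) N0 (PIA _)).
Qed.
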